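(* Let $1\le d<k$ be integers and let $Y$ be a $k$ to $d$ cubical cut and project set with physical space $E=\{(x,L_1(x),\ldots,L_{k-d}(x)):x\in\mathbb{R}^d\}$, where $L_1,\ldots,L_{k-d}:\mathbb{R}^d\to\mathbb{R}$ are linear forms. For each $i$ let $\mathcal{L}_i:\mathbb{Z}^d\to\mathbb{R}/\mathbb{Z}$ be the homomorphism $\mathcal{L}_i(n)=L_i(n)\bmod 1$. Then $Y$ is linearly repetitive if and only if both of the following conditions hold: (LR1) $\sum_{i=1}^{k-d}\mathrm{rk}(\ker\mathcal{L}_i)=d(k-d-1)$; (LR2) each $L_i$ ($1\le i\le k-d$) is relatively badly approximable.
   Context: Cut and project sets. Let $E=\{(x,L(x)):x\in\mathbb{R}^d\}\subseteq\mathbb{R}^k$ with $L=(L_1,\ldots,L_{k-d}):\mathbb{R}^d\to\mathbb{R}^{k-d}$ linear (the physical space), and let $F_\pi\subseteq\mathbb{R}^k$ be a subspace complementary to $E$ (the internal space). Let $\pi:\mathbb{R}^k\to E$ be the projection onto $E$ with respect to $\mathbb{R}^k=E+F_\pi$; it is assumed that $\pi|_{\mathbb{Z}^k}$ is injective. Let $F_\rho=\{0\}\times\mathbb{R}^{k-d}$, and let $\rho:\mathbb{R}^k\to E$ and $\rho^*:\mathbb{R}^k\to F_\rho$ be the projections with respect to $\mathbb{R}^k=E+F_\rho$. Given a window $\mathcal{W}\subseteq F_\rho$, the strip is $\mathcal{S}=\mathcal{W}+E$, and for $s\in\mathbb{R}^k/\mathbb{Z}^k$ the $k$ to $d$ cut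 and project set is $Y=Y_s=\pi(\mathcal{S}\cap(\mathbb{Z}^k+s))\subseteq E$. It is regular if $(\mathbb{Z}^k+s)\cap\partial\mathcal{S}=\emptyset$; totally irrational if the image of $E$ in $\mathbb{R}^k/\mathbb{Z}^k$ is dense; aperiodic if the only $x\in E$ with $Y+x=Y$ is $x=0$. The cubical window is $\mathcal{W}=\{\sum_{i=d+1}^k t_ie_i:0\le t_i<1\}$. A cubical cut and project set is a regular, totally irrational, aperiodic cut and project set with the cubical window. Linear repetitivity. For $y\in Y$ let $\tilde y$ be the unique point of $\mathcal{S}\cap(\mathbb{Z}^k+s)$ with $\pi(\tilde y)=y$. Fix a bounded convex $\Omega\subseteq E$ containing a neighborhood of $0$ in $E$. The patch of size $r$ at $y\in Y$ is $P(y,r)=\{y'\in Y:\rho(\tilde{y'}-\tilde y)\in r\Omega\}$; patches $P(y_1,r)$ and $P(y_2,r)$ are equivalent if $P(y_1,r)=P(y_2,r)+y_1-y_2$. $Y$ is linearly repetitive (LR) if there is $C>0$ such that for every $r\ge1$ and every $y\in Y$, every ball of diameter $Cr$ in $E$ contains a point $y'\in Y$ with $P(y',r)$ equivalent to $P(y,r)$. (This property does not depend on the choice of $\Omega$.) Relatively badly approximable. For a linear form $L:\mathbb{R}^d\to\mathbb{R}$ put $\mathcal{L}(n)=L(n)\bmod1$ for $n\in\mathbb{Z}^d$, $S=\ker\mathcal{L}\leqslant\mathbb{Z}^d$ and $m=d-\mathrm{rk}(S)$. $L$ is relatively badly approximable if $m>0$ and there exist $C>0$ and a subgroup $\Lambda\leqslant\mathbb{Z}^d$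 of rank $m$ with $\Lambda\cap S=\{0\}$ and $\|\mathcal{L}(\lambda)\|\ge C/|\lambda|^m$ for all $\lambda\in\Lambda\setminus\{0\}$. Here $\|\cdot\|$ is the distance to the nearest integer and $|\cdot|$ is the maximum norm. *)

(* Defs.v *)
From HB Require Import structures.
From mathcomp Require Import all_boot all_order all_algebra.
From mathcomp Require Import all_classical all_reals all_analysis.
Import Order.TTheory GRing.Theory Num.Theory.
Import numFieldNormedType.Exports.

Set Implicit Arguments.
Unset Strict Implicit.
Unset Printing Implicit Defensive.

Local Open Scope classical_set_scope.
Local Open Scope ring_scope.
Local Open Scope quotient_scope.

(* Conventions: [c] is the codimension k - d, the total space R^k is
   'rV[R]_(d + c), and the norm and balls are those of the library on row
   vectors, i.e. those of the maximum norm. *)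

Definition int_lattice (R : realType) (n : nat) : set 'rV[R]_n :=
  [set map_mx intr z | z in [set: 'rV[int]_n]].
Arguments int_lattice : clear implicits.

Definition lattice_congr (R : realType) (n : nat) : rel 'rV[R]_n :=
  fun x y => `[< int_lattice R n (x - y) >].

Lemma lattice_congr_equiv (R : realType) (n : nat) :
  equiv_class_of (@lattice_congr R n).
Proof.
split=> [x|x y|y x z].
- by apply/asboolP; exists 0 => //; rewrite map_mx0 subrr.
- by apply/asboolP/asboolP => -[u _ eu]; exists (- u) => //;
    rewrite map_mxN eu opprB.
- move=> /asboolP[u _ eu] /asboolP[v _ ev]; apply/asboolP; exists (u + v) => //.
  by rewrite map_mxD eu ev addrA subrK.
Qed.

Canonical lattice_equiv_rel (R : realType) (n : nat) :=
  EquivRelPack (@lattice_congr_equiv R n).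

(* R^n / Z^n with the quotient topology. *)
Definition torus (R : realType) (n : nat) : topologicalType :=
  quotient_topology {eq_quot (@lattice_equiv_rel R n)}.

Definition torus_pi (R : realType) (n : nat) (x : 'rV[R]_n) : torus R n :=
  (\pi_{eq_quot (@lattice_equiv_rel R n)} x).

(* The coset Z^n + s, for s in R^n / Z^n. *)
Definition lattice_coset (R : realType) (n : nat) (s : torus R n) :
    set 'rV[R]_n :=
  @torus_pi R n @^-1` [set s].

Lemma lattice_cosetE (R : realType) (n : nat) (x : 'rV[R]_n) :
  lattice_coset (torus_pi x) = [set z + x | z in int_lattice R n].
Proof.
apply/seteqP; split=> [y /= /eqmodP /asboolP yx|_ [z zZ <-]].
  by exists (y - x) => //; rewrite subrK.
by apply/eqmodP/asboolP; rewrite addrK.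
Qed.

Definition graph_map (R : realType) (d c : nat) (L : 'I_c -> {scalar 'rV[R]_d})
    (x : 'rV[R]_d) : 'rV[R]_(d + c) :=
  row_mx x (\row_i L i x).

Definition physical (R : realType) (d c : nat)
    (L : 'I_c -> {scalar 'rV[R]_d}) : {vspace 'rV[R]_(d + c)} :=
  limg (linfun (graph_map L)).

Definition physical_set (R : realType) (d c : nat)
    (L : 'I_c -> {scalar 'rV[R]_d}) : set 'rV[R]_(d + c) :=
  [set v | v \in physical L].

(* The subspace {0} x R^c. *)
Definition F_rho (R : realType) (d c : nat) : {vspace 'rV[R]_(d + c)} :=
  limg (linfun (fun t : 'rV[R]_c => row_mx (0 : 'rV[R]_d) t)).

Lemma memv_physical (R : realType) (d c : nat)
    (L : 'I_c -> {scalar 'rV[R]_d}) (v : 'rV[R]_(d + c)) :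
  v \in physical L <-> exists x, v = graph_map L x.
Proof.
have lin : linear (graph_map L).
  move=> a x y; rewrite /graph_map scale_row_mx add_row_mx; congr row_mx.
  by apply/rowP => i; rewrite !mxE linearP.
pose g : {linear 'rV[R]_d -> 'rV[R]_(d + c)} := HB.pack (graph_map L)
  (GRing.isLinear.Build R 'rV[R]_d 'rV[R]_(d + c) *:%R (graph_map L) lin).
split=> [/memv_imgP[x _ ->]|[x ->]]; first by exists x; rewrite (lfunE g).
by apply/memv_imgP; exists x; rewrite ?memvf// (lfunE g).
Qed.

Lemma memv_F_rho (R : realType) (d c : nat) (v : 'rV[R]_(d + c)) :
  v \in F_rho R d c <-> exists t : 'rV[R]_c, v = row_mx 0 t.
Proof.
pose f (t : 'rV[R]_c) := row_mx (0 : 'rV[R]_d) t.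
have lin : linear f.
  by move=> a x y; rewrite /f scale_row_mx add_row_mx scaler0 addr0.
pose g : {linear 'rV[R]_c -> 'rV[R]_(d + c)} := HB.pack f
  (GRing.isLinear.Build R 'rV[R]_c 'rV[R]_(d + c) *:%R f lin).
split=> [/memv_imgP[x _ ->]|[x ->]]; first by exists x; rewrite (lfunE g).
by apply/memv_imgP; exists x; rewrite ?memvf// (lfunE g).
Qed.

Definition complementary (K : fieldType) (V : vectType K) (E F : {vspace V}) :=
  (E + F = fullv)%VS /\ (E :&: F = 0)%VS.

Lemma physical_F_rho (R : realType) (d c : nat)
    (L : 'I_c -> {scalar 'rV[R]_d}) :
  complementary (physical L) (F_rho R d c).
Proof.
split; apply/vspaceP => v; rewrite ?memvf.
  apply/memv_addP; exists (graph_map L (lsubmx v)).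
    by apply/memv_physical; exists (lsubmx v).
  exists (row_mx 0 (rsubmx v - \row_i L i (lsubmx v))).
    by apply/memv_F_rho; eexists.
  by rewrite add_row_mx addr0 addrC subrK hsubmxK.
rewrite memv_cap memv0; apply/andP/eqP => [[]|->]; last by rewrite !mem0v.
move=> /memv_physical[x ->] /memv_F_rho[t /eq_row_mx[-> _]].
by rewrite /graph_map -row_mx0; congr row_mx; apply/rowP => i;
  rewrite !mxE linear0.
Qed.

Definition proj_rho (R : realType) (d c : nat) (L : 'I_c -> {scalar 'rV[R]_d}) :
    'End('rV[R]_(d + c)) :=
  daddv_pi (physical L) (F_rho R d c).

Definition proj_pi (R : realType) (d c : nat) (L : 'I_c -> {scalar 'rV[R]_d})
    (F : {vspace 'rV[R]_(d + c)}) : 'End('rV[R]_(d + c)) :=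
  daddv_pi (physical L) F.

Definition cubical_window (R : realType) (d c : nat) : set 'rV[R]_(d + c) :=
  [set w | exists t : 'rV[R]_c,
     (forall i, 0 <= t 0 i < 1) /\ w = row_mx 0 t].
Arguments cubical_window : clear implicits.

Definition strip (R : realType) (d c : nat) (L : 'I_c -> {scalar 'rV[R]_d})
    (W : set 'rV[R]_(d + c)) : set 'rV[R]_(d + c) :=
  [set w + x | w in W & x in physical_set L].

Definition strip_points (R : realType) (d c : nat)
    (L : 'I_c -> {scalar 'rV[R]_d}) (W : set 'rV[R]_(d + c))
    (s : torus R (d + c)) : set 'rV[R]_(d + c) :=
  strip L W `&` lattice_coset s.

Definition cut_project (R : realType) (d c : nat)
    (L : 'I_c -> {scalar 'rV[R]_d}) (F : {vspace 'rV[R]_(d + c)})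
    (W : set 'rV[R]_(d + c)) (s : torus R (d + c)) : set 'rV[R]_(d + c) :=
  proj_pi L F @` strip_points L W s.

(* Standing assumptions on the internal space and on the projection pi. *)
Definition admissible_internal (R : realType) (d c : nat)
    (L : 'I_c -> {scalar 'rV[R]_d}) (F : {vspace 'rV[R]_(d + c)}) : Prop :=
  complementary (physical L) F /\
  set_inj (int_lattice R (d + c)) (proj_pi L F).

Definition regular (R : realType) (d c : nat) (L : 'I_c -> {scalar 'rV[R]_d})
    (W : set 'rV[R]_(d + c)) (s : torus R (d + c)) : Prop :=
  lattice_coset s `&` (closure (strip L W) `\` interior (strip L W)) = set0.

Definition totally_irrational (R : realType) (d c : nat)
    (L : 'I_c -> {scalar 'rV[R]_d}) : Prop :=
  dense (@torus_pi R (d + c) @` physical_set L).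

Definition aperiodic (R : realType) (d c : nat) (L : 'I_c -> {scalar 'rV[R]_d})
    (Y : set 'rV[R]_(d + c)) : Prop :=
  forall x, x \in physical L -> [set y + x | y in Y] = Y -> x = 0.

(* [cubical_cut_project L F s] states that the data define a cubical cut and
   project set; the set itself is then [cut_project L F (cubical_window R d c) s]. *)
Definition cubical_cut_project (R : realType) (d c : nat)
    (L : 'I_c -> {scalar 'rV[R]_d}) (F : {vspace 'rV[R]_(d + c)})
    (s : torus R (d + c)) : Prop :=
  [/\ admissible_internal L F,
      regular L (cubical_window R d c) s,
      totally_irrational L &
      aperiodic L (cut_project L F (cubical_window R d c) s)].

(* The unique point of the strip and of Z^k + s above y. *)
Definition lift_point (R : realType) (d c : nat)
    (L : 'I_c -> {scalar 'rV[R]_d}) (F : {vspace 'rV[R]_(d + c)})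
    (W : set 'rV[R]_(d + c)) (s : torus R (d + c)) (y : 'rV[R]_(d + c)) :
    'rV[R]_(d + c) :=
  get [set p | strip_points L W s p /\ proj_pi L F p = y].

Definition patch_shape (R : realType) (d c : nat)
    (L : 'I_c -> {scalar 'rV[R]_d}) (Omega : set 'rV[R]_(d + c)) : Prop :=
  [/\ Omega `<=` physical_set L,
      bounded_set Omega,
      convex_set Omega &
      \forall x \near within (physical_set L) (nbhs (0 : 'rV[R]_(d + c))), Omega x].

Definition patch (R : realType) (d c : nat) (L : 'I_c -> {scalar 'rV[R]_d})
    (F : {vspace 'rV[R]_(d + c)}) (W : set 'rV[R]_(d + c))
    (s : torus R (d + c)) (Omega : set 'rV[R]_(d + c))
    (y : 'rV[R]_(d + c)) (r : R) : set 'rV[R]_(d + c) :=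
  [set y' | cut_project L F W s y' /\
     [set r *: w | w in Omega]
       (proj_rho L (lift_point L F W s y' - lift_point L F W s y))].

Definition patch_equiv (R : realType) (d c : nat)
    (L : 'I_c -> {scalar 'rV[R]_d}) (F : {vspace 'rV[R]_(d + c)})
    (W : set 'rV[R]_(d + c)) (s : torus R (d + c))
    (Omega : set 'rV[R]_(d + c)) (r : R) (y1 y2 : 'rV[R]_(d + c)) : Prop :=
  patch L F W s Omega y1 r =
  [set y + y1 - y2 | y in patch L F W s Omega y2 r].

Definition linearly_repetitive (R : realType) (d c : nat)
    (L : 'I_c -> {scalar 'rV[R]_d}) (F : {vspace 'rV[R]_(d + c)})
    (W : set 'rV[R]_(d + c)) (s : torus R (d + c))
    (Omega : set 'rV[R]_(d + c)) : Prop :=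
  exists2 C : R, 0 < C &
    forall r y, 1 <= r -> cut_project L F W s y ->
    forall x, x \in physical L ->
    exists y' : 'rV[R]_(d + c),
      [/\ ball x (C * r / 2) y', cut_project L F W s y' &
          patch_equiv L F W s Omega r y' y].

(* The rank of a subgroup of Z^d: the maximal number of Z-linearly independent
   elements (which is at most d). *)
Definition rk (d : nat) (A : {pred 'rV[int]_d}) : nat :=
  \max_(r < d.+1 |
     `[< exists M : 'M[int]_(r, d),
           (forall i, row i M \in A) /\
           (forall u : 'rV[int]_r, u *m M = 0 -> u = 0) >]) r.

(* The kernel of n |-> l n mod 1 on Z^d. *)
Definition ker_mod1 (R : realType) (d : nat) (l : {scalar 'rV[R]_d}) :
    {pred 'rV[int]_d} :=
  [pred n | l (map_mx intr n) \is a Num.int].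

Definition dist_int (R : realType) (x : R) : R :=
  inf [set `|x - z%:~R| | z in [set: int]].

Definition relatively_badly_approximable (R : realType) (d : nat)
    (l : {scalar 'rV[R]_d}) : Prop :=
  let S := ker_mod1 l in
  let m := (d - rk S)%N in
  (0 < m)%N /\
  exists C : R, 0 < C /\
  exists Lambda : {pred 'rV[int]_d},
    [/\ zmod_closed Lambda,
        rk Lambda = m,
        (forall n, n \in Lambda -> n \in S -> n = 0) &
        forall n, n \in Lambda -> n != 0 ->
          C / `|map_mx intr n : 'rV[R]_d| ^+ m <= dist_int (l (map_mx intr n))].

(* Main.v *)
Require Import Defs.
From HB Require Import structures.
From mathcomp Require Import all_boot all_order all_algebra.
From mathcomp Require Import all_classical all_reals all_analysis.
From mathcomp Require Import zify ring lra.
Import Order.TTheory GRing.Theory Num.Theory.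
Import numFieldNormedType.Exports.

(* The points of Y are indexed by n in Z^d.  With theta_i - L_i(n) taken mod 1,
   the patch of size r at n is described by the position of these c numbers with
   respect to the cuts L_i(k), |k| <= r, independently in each coordinate i.  Put
   m_i = d - rk (ker L_i mod 1); aperiodicity gives \sum m_i >= d, and (LR1)
   says that equality holds.

   If Y is LR, the about r^(\sum m_i) patterns of size r all occur in a box of
   side O(r), so \sum m_i <= d.  Moreover a very short interval cut out in the
   i-th coordinate would still carry about r^(d - m_i) patterns, hence that many
   points in every box of side O(r), more than its length allows: this bounds
   the distance from L_i(n) to the integers from below by a multiple of
   |n|^(- m_i).

   Conversely, under (LR1) and (LR2) the lattice of the vectors
   (n / X, X^(m_i) (L_i(n) - p_i)) in R^(d + c) is unimodular with no short
   nonzero vector, uniformly in X, so its covering radius is bounded; and the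
   cells of size r have length at least a multiple of r^(- m_i), so each of them
   is visited in every box of side O(r). *)

Set Implicit Arguments.
Unset Strict Implicit.
Unset Printing Implicit Defensive.

Local Open Scope classical_set_scope.
Local Open Scope ring_scope.

(** * Ranks of subgroups of Z^d *)

Lemma common_denominator (m n : nat) (A : 'M[rat]_(m, n)) :
  exists2 N : int, N != 0 & exists B : 'M[int]_(m, n), map_mx intr B = N%:~R *: A.
Proof.
pose N : int := \prod_i \prod_j denq (A i j).
have NZ i j : N%:~R * A i j \is a Num.int.
  have [K ->] : exists K, N = K * denq (A i j).
    rewrite /N (bigD1 i) //= (bigD1 j) //=; set a := \prod_(_ | _) _.
    by set b := \prod_(_ | _) _; exists (a * b); ring.
  rewrite intrM -mulrA -{2}(divq_num_den (A i j)) mulrC.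
  have d0 : (denq (A i j))%:~R != 0 :> rat by rewrite intr_eq0 denq_neq0.
  by rewrite (mulrC (denq _)%:~R) divfK // -intrM intr_int.
exists N.
  by apply/prodf_neq0 => i _; apply/prodf_neq0 => j _; rewrite denq_neq0.
exists (\matrix_(i, j) Num.floor (N%:~R * A i j)).
by apply/matrixP => i j; rewrite !mxE floorK.
Qed.

Definition int_free (m n : nat) (M : 'M[int]_(m, n)) : Prop :=
  forall u : 'rV[int]_m, u *m M = 0 -> u = 0.

Lemma map_intmx_inj (K : numDomainType) (m n : nat) :
  injective (map_mx intr : 'M[int]_(m, n) -> 'M[K]_(m, n)).
Proof.
by move=> A B /matrixP AB; apply/matrixP => i j; have := AB i j;
  rewrite !mxE => /intr_inj.
Qed.

(** A rational relation between the rows becomes integral once its denominators are cleared, so rank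
    arguments can be made over the field [rat]. *)
Lemma int_freeP (m n : nat) (M : 'M[int]_(m, n)) :
  int_free M <-> row_free (map_mx intr M : 'M[rat]_(m, n)).
Proof.
split=> [fM|fM u uM].
  apply: inj_row_free => v vM.
  have [N N0 [B BE]] := common_denominator v.
  have B0 : B = 0.
    apply/fM/(@map_intmx_inj rat); rewrite map_mxM BE -scalemxAl vM scaler0.
    by rewrite map_mx0.
  move/eqP: BE; rewrite B0 map_mx0 eq_sym scaler_eq0 intr_eq0 (negPf N0).
  by move=> /eqP.
apply/(@map_intmx_inj rat)/(row_free_inj fM) => /=.
by rewrite -map_mxM uM !map_mx0 mul0mx.
Qed.

Lemma int_free_leq (m n : nat) (M : 'M[int]_(m, n)) : int_free M -> (m <= n)%N.
Proof. by move=> /int_freeP /eqP <-; apply: rank_leq_col. Qed.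

Lemma int_free_mull (m n p : nat) (A : 'M[int]_(m, n)) (B : 'M[int]_(n, p)) :
  int_free (A *m B) -> int_free A.
Proof. by move=> AB u uA; apply: AB; rewrite mulmxA uA mul0mx. Qed.

Lemma rk_leq (d : nat) (A : {pred 'rV[int]_d}) : (rk A <= d)%N.
Proof. by apply/bigmax_leqP => i _; rewrite -ltnS. Qed.

Lemma rk_basis (d : nat) (A : {pred 'rV[int]_d}) :
  exists2 M : 'M[int]_(rk A, d), (forall i, row i M \in A) & int_free M.
Proof.
pose P (r : 'I_d.+1) := `[< exists M : 'M[int]_(r, d),
  (forall i, row i M \in A) /\ int_free M >].
have P0 : P ord0.
  by apply/asboolP; exists 0; split=> [[]//|u _]; apply/rowP => -[].
have card0 : (0 < #|P|)%N by apply/card_gt0P; exists ord0.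
have [r /asboolP[M [MA Mf]] rE] := eq_bigmax_cond (fun r : 'I_d.+1 => r : nat) card0.
have {}rE : rk A = r by exact: rE.
rewrite rE.
by exists M.
Qed.

Lemma rk_max (d r : nat) (A : {pred 'rV[int]_d}) (M : 'M[int]_(r, d)) :
  (forall i, row i M \in A) -> int_free M -> (r <= rk A)%N.
Proof.
move=> MA Mf; have rd : (r < d.+1)%N by rewrite ltnS (int_free_leq Mf).
apply: (@leq_bigmax_cond _ _ (fun r : 'I_d.+1 => r : nat) (Ordinal rd)).
by apply/asboolP; exists M.
Qed.

Lemma zmod_closed_comb (d r : nat) (A : {pred 'rV[int]_d}) (M : 'M[int]_(r, d))
    (u : 'rV[int]_r) :
  zmod_closed A -> (forall i, row i M \in A) -> u *m M \in A.
Proof.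
move=> [A0 AB] MA.
have AN x : x \in A -> - x \in A by move=> xA; rewrite -sub0r AB.
have AD x y : x \in A -> y \in A -> x + y \in A.
  by move=> xA yA; rewrite -[y]opprK AB // AN.
have AM x n : x \in A -> x *+ n \in A.
  by move=> xA; elim: n => [|n IH]; rewrite ?mulr0n // mulrS AD.
rewrite mulmx_sum_row; apply: (big_ind (fun x => x \in A)) => // i _.
rewrite -[u 0 i]intz scaler_int.
by case: (u 0 i) => n; rewrite ?NegzE ?mulrNz -pmulrn ?AN // AM.
Qed.

(** The rows of [P] form a basis of a rational complement of the row space of [M], scaled by a
    common denominator; [M] and [P] together span a subgroup of finite index. *)
Lemma int_free_complement (k d : nat) (M : 'M[int]_(k, d)) :
  int_free M -> exists P : 'M[int]_(d - k, d), int_free (col_mx M P).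
Proof.
move=> Mf; have kd := int_free_leq Mf.
pose A : 'M[rat]_(k, d) := map_mx intr M.
have rA : \rank A = k by apply/eqP/int_freeP.
have rC : \rank (A^C)%MS = (d - k)%N by rewrite mxrank_compl rA.
pose B := castmx (rC, erefl d) (row_base (A^C)%MS).
have BE : (B :=: A^C)%MS by apply: eqmx_trans (eqmx_cast _ _) (eq_row_base _).
have AB : row_free (col_mx A B).
  rewrite -row_leq_rank -addsmxE (adds_eqmx (eqmx_refl A) BE).
  by rewrite (eqP (addsmx_compl_full A)) subnKC.
have [N N0 [P PE]] := common_denominator B.
exists P => u; rewrite -[u]hsubmxK mul_row_col => uMP.
have : row_mx (map_mx intr (lsubmx u)) (N%:~R *: map_mx intr (rsubmx u)) *m
    col_mx A B = 0.
  rewrite mul_row_col -scalemxAl scalemxAr -PE -!map_mxM -map_mxD uMP.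
  by rewrite map_mx0.
rewrite -(mul0mx _ (col_mx A B)) => /(row_free_inj AB) /eqP.
rewrite -row_mx0 => /eqP /eq_row_mx [/eqP u1 /eqP]; rewrite scaler_eq0 intr_eq0.
rewrite (negPf N0) /= => u2.
have {}u1 : lsubmx u = 0 by apply/(@map_intmx_inj rat); rewrite map_mx0; apply/eqP.
have {}u2 : rsubmx u = 0 by apply/(@map_intmx_inj rat); rewrite map_mx0; apply/eqP.
by rewrite u1 u2 row_mx0.
Qed.

(** Freeness forces n <= d, so [B] is invertible over the rationals, and [Q] is its inverse times a
    common denominator. Asking for d <= n rather than for a square matrix avoids casts when n is a
    sum such as k + (d - k). *)
Lemma int_free_decomp (n d : nat) (B : 'M[int]_(n, d)) :
  (d <= n)%N -> int_free B ->
  exists2 N : int, N != 0 &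
    exists Q : 'M[int]_(d, n), forall x : 'rV[int]_d, N *: x = x *m Q *m B.
Proof.
move=> dn /int_freeP Bf.
have Bfull : row_full (map_mx intr B : 'M[rat]_(n, d)).
  by rewrite -col_leq_rank (eqP Bf).
have [N N0 [Q QE]] := common_denominator (pinvmx (map_mx intr B : 'M[rat]_(n, d))).
exists N => //; exists Q => x.
have QB : Q *m B = N%:M.
  apply: (@map_intmx_inj rat); rewrite map_mxM QE -scalemxAl.
  rewrite -[pinvmx _]mul1mx mulmxKpV ?submx_full //.
  by rewrite map_scalar_mx scalemx1.
by rewrite -mulmxA QB mul_mx_scalar.
Qed.

(** Each [S i] comes with a linear map to Z^(d - rk (S i)) whose kernel is carried into [S i] by a
    nonzero multiplier. If the codimensions added up to less than d, the joint map would kill a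
    nonzero vector, and a nonzero multiple of it would lie in every [S i]. *)
Lemma rk_sum_ge (d c : nat) (S : 'I_c -> {pred 'rV[int]_d}) :
  (forall i, zmod_closed (S i)) ->
  (forall n, (forall i, n \in S i) -> n = 0) ->
  (d <= \sum_i (d - rk (S i)))%N.
Proof.
move=> Sz S0; rewrite leqNgt; apply/negP => lt.
pose good i (N : int) (Q : 'M[int]_(d, d - rk (S i))) :=
  N != 0 /\ forall x, x *m Q = 0 -> N *: x \in S i.
have /(_ _)/cid -/all_sig[NQ NQP] : forall i,
    exists NQ : int * 'M[int]_(d, d - rk (S i)), good i NQ.1 NQ.2.
  move=> i; have [M MS Mf] := rk_basis (S i).
  have [P Pf] := int_free_complement Mf.
  have [|N N0 [Q QE]] := int_free_decomp _ Pf; first by rewrite subnKC // rk_leq.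
  (* [rsubmx Q] reads off the coordinates along the complement [P]; when they vanish, N x is a
     combination of the basis of [S i]. *)
  exists (N, rsubmx Q); split=> // x xQ.
  rewrite QE -[Q]hsubmxK mul_mx_row mul_row_col xQ mul0mx addr0.
  exact: zmod_closed_comb.
pose Q : 'M[int]_(d, \sum_i (d - rk (S i))) := \mxrow_i (NQ i).2.
have nf : ~ int_free Q by move=> /int_free_leq; rewrite leqNgt lt.
apply: nf => x xQ.
have xQi i : x *m (NQ i).2 = 0.
  have := xQ; rewrite /Q mul_mxrow -(mxrow0 _) => /eq_mxrowP; exact.
pose N : int := \prod_i (NQ i).1.
have N0 : N != 0 by apply/prodf_neq0 => i _; case: (NQP i).
have : N *: x = 0.
  apply: S0 => i; rewrite /N (bigD1 i) //= mulrC -scalerA.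
  have [_ /(_ _ (xQi i)) xS] := NQP i.
  set a := \prod_(_ | _) _.
  have := @zmod_closed_comb d 1 (S i) ((NQ i).1 *: x) a%:M (Sz i).
  by rewrite mul_scalar_mx; apply=> j; rewrite ord1 row_id.
by move/eqP; rewrite scalemx_eq0 (negPf N0) => /eqP.
Qed.

(** * Bad approximability relative to the kernel *)

Lemma rV_norm_leP (R : realType) (n : nat) (v : 'rV[R]_n) (x : R) :
  0 <= x -> (`|v| <= x) <-> forall j, `|v 0 j| <= x.
Proof.
move=> x0; rewrite [`|v|]/Num.norm /= mx_normrE; split.
  by move=> /bigmax_leP[_ h] j; apply: (h (0, j)).
by move=> h; apply/bigmax_leP; split=> // -[i j] _; rewrite ord1.
Qed.

Lemma rV_coord_le (R : realType) (n : nat) (v : 'rV[R]_n) j : `|v 0 j| <= `|v|.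
Proof. exact: (rV_norm_leP v (normr_ge0 v)).1. Qed.

Lemma mulmx_norm_bound (R : realType) (m n : nat) (A : 'M[R]_(m, n)) :
  exists2 K : R, 0 < K & forall u : 'rV[R]_m, `|u *m A| <= K * `|u|.
Proof.
exists (1 + \sum_i \sum_j `|A i j|).
  by rewrite ltr_pwDl // sumr_ge0 // => i _; rewrite sumr_ge0.
move=> u; apply/rV_norm_leP => [|j].
  by rewrite mulr_ge0 // addr_ge0 // sumr_ge0 // => i _; rewrite sumr_ge0.
rewrite mxE (le_trans (ler_norm_sum _ _ _)) //.
rewrite mulrDl mul1r ler_wpDl // mulr_suml ler_sum // => i _.
rewrite normrM mulrC ler_pM ?rV_coord_le //.
by rewrite (bigD1 j) //= lerDl sumr_ge0.
Qed.

Lemma intV_norm_ge1 (R : realType) (d : nat) (n : 'rV[int]_d) :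
  n != 0 -> 1 <= `|map_mx intr n : 'rV[R]_d|.
Proof.
move=> /rV0Pn[j nj]; apply: le_trans (rV_coord_le _ j); rewrite mxE.
by rewrite -intr_norm ler1z -gtz0_ge1 normr_gt0.
Qed.

Section Distance.
Variable R : realType.
Implicit Types x y a : R.

Lemma dist_int_le x (z : int) : dist_int x <= `|x - z%:~R|.
Proof.
by apply: ge_inf; [exists 0 => _ [w _ <-]; apply: normr_ge0 | exists z].
Qed.

Lemma le_dist_int x a : (forall z : int, a <= `|x - z%:~R|) -> a <= dist_int x.
Proof.
move=> h; apply: lb_le_inf; first by exists `|x - 0%:~R|; exists 0.
by move=> _ [z _ <-].
Qed.

Lemma dist_intMz x (N : int) : dist_int (N%:~R * x) <= `|N%:~R| * dist_int x.
Proof.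
have [->|N0] := eqVneq N 0.
  by rewrite normr0 !mul0r (le_trans (dist_int_le 0 0)) // subrr normr0.
have N1 : 0 < `|N%:~R : R| by rewrite normr_gt0 intr_eq0.
rewrite -ler_pdivrMl //; apply: le_dist_int => z.
rewrite ler_pdivrMl // -normrM (le_trans (dist_int_le _ (z * N))) //.
by rewrite mulrBr intrM (mulrC z%:~R).
Qed.

Lemma dist_intDz x y : y \is a Num.int -> dist_int (x + y) = dist_int x.
Proof.
have le (u v : R) : v \is a Num.int -> dist_int (u + v) <= dist_int u.
  move=> /intrP[w ->]; apply: le_dist_int => z.
  rewrite (le_trans (dist_int_le _ (z + w))) // intrD opprD addrACA subrr.
  by rewrite addr0.
move=> yZ; apply/le_anti; rewrite le //= -{1}[x](addrK y) le //.
by rewrite rpredN.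
Qed.

Lemma dist_int_ge_frac x : let f := (Num.floor x)%:~R in
  Num.min (x - f) (f + 1 - x) <= dist_int x.
Proof.
set f := Num.floor x => /=; have /andP[fx xf] := floor_itv x.
rewrite intrD -/f in fx xf; apply: le_dist_int => z; rewrite ge_min.
have [zf|fz] := leP z f.
  have : z%:~R <= f%:~R :> R by rewrite ler_int.
  move=> h; apply/orP; left; rewrite ger0_norm; lra.
have : (f + 1)%:~R <= z%:~R :> R by rewrite ler_int lezD1.
rewrite intrD => h; apply/orP; right; rewrite ler0_norm; lra.
Qed.

Lemma dist_int_ge_inv x (N : int) :
  N != 0 -> N%:~R * x \is a Num.int -> x \isn't a Num.int ->
  `|N%:~R|^-1 <= dist_int x.
Proof.
move=> N0 /intrP[w Nx] xZ; apply: le_dist_int => z.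
have N1 : 0 < `|N%:~R : R| by rewrite normr_gt0 intr_eq0.
rewrite -[leLHS]mul1r ler_pdivrMr // mulrC -normrM mulrBr Nx -intrM -intrB.
rewrite -intr_norm ler1z -gtz0_ge1 normr_gt0 subr_eq0.
apply: contra xZ => /eqP wE; apply/intrP; exists z.
by apply: (@mulfI _ (N%:~R : R)); rewrite ?intr_eq0 // Nx wE intrM.
Qed.

End Distance.

Section Forms.
Variables (R : realType) (d : nat).

Definition int_form (l : {scalar 'rV[R]_d}) (n : 'rV[int]_d) : R :=
  l (map_mx intr n).

Lemma int_form_is_zmod_morphism l : zmod_morphism (int_form l).
Proof. by move=> a b; rewrite /int_form map_mxB linearB. Qed.

HB.instance Definition _ l := GRing.isZmodMorphism.Build _ _ (int_form l)
  (int_form_is_zmod_morphism l).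

Lemma int_formD (l : {scalar 'rV[R]_d}) a b :
  int_form l (a + b) = int_form l a + int_form l b.
Proof. exact: raddfD. Qed.

Lemma int_formZ l (N : int) n : int_form l (N *: n) = N%:~R * int_form l n.
Proof. by rewrite -[N in LHS]intz scaler_int raddfMz mulrzl. Qed.

Lemma ker_mod1E (l : {scalar 'rV[R]_d}) n : (n \in ker_mod1 l) = (int_form l n \is a Num.int).
Proof. by []. Qed.

Lemma ker_mod1_zmod_closed (l : {scalar 'rV[R]_d}) : zmod_closed (ker_mod1 l).
Proof.
split=> [|a b]; rewrite !ker_mod1E ?raddf0 // raddfB => aZ bZ.
exact: rpredB.
Qed.

(** This is maximality of the rank: a nonzero combination of the rows of [P] lying in the kernel
    could be added to the basis [M] without destroying freeness. *)
Lemma ker_mod1_complement (l : {scalar 'rV[R]_d}) :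
  exists P : 'M[int]_(d - rk (ker_mod1 l), d),
    (forall v, v *m P \in ker_mod1 l -> v = 0) /\
    exists2 M : 'M[int]_(rk (ker_mod1 l), d),
      (forall i, row i M \in ker_mod1 l) & int_free (col_mx M P).
Proof.
have [M MS Mf] := rk_basis (ker_mod1 l).
have [P Pf] := int_free_complement Mf.
exists P; split=> [v vS|]; last by exists M.
apply: contraTeq isT => v0.
have /rk_max : forall i, row i (col_mx M (v *m P)) \in ker_mod1 l.
  move=> i; case: (split_ordP i) => j ->; first by rewrite rowKu.
  by rewrite rowKd ord1 row_id.
suff /[swap]/[apply] : int_free (col_mx M (v *m P)) by rewrite addn1 ltnn.
move=> w; rewrite -[w]hsubmxK mul_row_col mulmxA -mul_row_col => /Pf /eqP.
rewrite -row_mx0 => /eqP /eq_row_mx [w1 w2].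
rewrite w1 -[RHS]row_mx0; congr row_mx; apply/rowP => j; rewrite ord1 mxE.
have [k vk] := rV0Pn _ v0.
have /matrixP/(_ 0 k) := w2; rewrite !mxE big_ord1 => /eqP.
by rewrite mulf_eq0 (negPf vk) orbF mxE => /eqP.
Qed.

(* This form of relative bad approximability does not mention the complement,
   since any two complements of the kernel differ by a bounded finite-index
   distortion. *)
Lemma relatively_badly_approximableP (l : {scalar 'rV[R]_d}) :
  let m := (d - rk (ker_mod1 l))%N in
  relatively_badly_approximable l <->
  (0 < m)%N /\ exists2 c : R, 0 < c &
    forall n, n \notin ker_mod1 l ->
      c / `|map_mx intr n : 'rV[R]_d| ^+ m <= dist_int (int_form l n).
Proof.
move=> m; split; last first.
  case=> m0 [c c0 cP]; split=> //; exists c; split=> //.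
  have [P [PS [M MS MPf]]] := ker_mod1_complement l.
  exists (fun n => `[< exists v, n = v *m P >]).
  have PL v : v *m P \in (fun n => `[< exists v, n = v *m P >]).
    by apply/asboolP; exists v.
  have Pf : int_free P.
    move=> v vP; apply: PS; rewrite vP.
    by have [] := ker_mod1_zmod_closed l.
  split.
  - split; first by apply/asboolP; exists 0; rewrite mul0mx.
    move=> _ _ /asboolP[v ->] /asboolP[w ->]; rewrite -mulmxBl; exact: PL.
  - apply/eqP; rewrite eqn_leq; apply/andP; split; last first.
      by apply: (rk_max (M := P)) => // i; rewrite rowE; apply: PL.
    (* A free family in the span of [P] factors as W P; then W is free too, and it has only m
       columns. *)
    have [M' M'S M'f] := rk_basis (fun n : 'rV_d => `[< exists v, n = v *m P >]).
    pose W := \matrix_i projT1 (cid (elimT (asboolP _) (M'S i))).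
    have M'E : M' = W *m P.
      apply/row_matrixP => i; rewrite row_mul rowK.
      by case: (cid _).
    by rewrite M'E in M'f; apply: int_free_leq (int_free_mull M'f).
  - by move=> _ /asboolP[v ->] /PS ->; rewrite mul0mx.
  - move=> _ /asboolP[v ->] v0; apply: cP; apply: contra v0 => /PS ->.
    by rewrite mul0mx.
case=> m0 [C [C0 [Lam [Lz Lrk LS LC]]]]; split=> //.
have [M MS Mf] := rk_basis (ker_mod1 l).
have [P PL Pf] := rk_basis Lam.
have [Sz Lz'] := (ker_mod1_zmod_closed l, Lz).
have MPf : int_free (col_mx M P).
  move=> u; rewrite -[u]hsubmxK mul_row_col => /eqP.
  rewrite addr_eq0 => /eqP uv.
  have vP : rsubmx u *m P = 0.
    apply: LS; first exact: zmod_closed_comb.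
    rewrite -[_ *m P]opprK -uv -sub0r.
    by have [S0 SB] := Sz; apply: SB => //; exact: zmod_closed_comb.
  have /Pf v0 := vP; move: uv; rewrite vP oppr0 => /Mf ->.
  by rewrite v0 row_mx0.
have [|N N0 [Q QE]] := int_free_decomp _ MPf.
  by rewrite Lrk subnKC // rk_leq.
pose P' : 'M[R]_(_, _) := map_mx intr (rsubmx Q *m P).
have [K K0 KP] := mulmx_norm_bound P'.
have N1 : 0 < `|N%:~R : R| by rewrite normr_gt0 intr_eq0.
have KN m' : 0 < K ^+ m' * `|N%:~R| by rewrite mulr_gt0 // exprn_gt0.
(* The two terms serve two cases. If the component b of N n along [Lambda] vanishes, l(n) is a
   non-integral rational whose denominator divides N; otherwise the bound on [Lambda] applies to b,
   with |b| <= K |n|. *)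
exists (Num.min `|N%:~R|^-1 (C / (K ^+ m * `|N%:~R|))).
  by rewrite lt_min invr_gt0 N1 divr_gt0.
move=> n nS.
have n0 : n != 0.
  by apply: contra nS => /eqP ->; have [] := Sz.
have n1 := intV_norm_ge1 R n0.
have nm : 1 <= `|map_mx intr n : 'rV[R]_d| ^+ m by apply: exprn_ege1.
set a := lsubmx (n *m Q) *m M; set b := rsubmx (n *m Q) *m P.
have nE : N *: n = a + b.
  by rewrite QE -[n *m Q]hsubmxK mul_row_col.
have aS : a \in ker_mod1 l by apply: zmod_closed_comb.
have bL : b \in Lam by apply: zmod_closed_comb.
have lE : dist_int (N%:~R * int_form l n) = dist_int (int_form l b).
  by rewrite -int_formZ nE raddfD addrC dist_intDz.
have [b0|b0] := eqVneq b 0.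
  apply: (@le_trans _ _ `|N%:~R|^-1).
    rewrite ler_pdivrMr ?(lt_le_trans ltr01) // (@le_trans _ _ `|N%:~R|^-1) //.
      by rewrite ge_min lexx.
    by rewrite ler_peMr // invr_ge0 ltW.
  apply: dist_int_ge_inv => //; first by rewrite -int_formZ nE b0 addr0.
have bK : `|map_mx intr b : 'rV[R]_d| <= K * `|map_mx intr n : 'rV[R]_d|.
  have -> : b = n *m (rsubmx Q *m P).
    by rewrite /b -{1}[Q]hsubmxK mul_mx_row row_mxKr mulmxA.
  by rewrite map_mxM; apply: KP.
have b1 := intV_norm_ge1 R b0.
have b1' := lt_le_trans ltr01 b1.
have := LC b bL b0; rewrite -[l _]/(int_form l b) -lE -/m => /le_trans.
move=> /(_ _ (dist_intMz _ _)) h.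
rewrite -(ler_pM2l N1); apply: le_trans h.
apply: (@le_trans _ _ (`|N%:~R| * (C / (K ^+ m * `|N%:~R|) /
    `|map_mx intr n : 'rV[R]_d| ^+ m))).
  rewrite ler_wpM2l // ler_wpM2r ?invr_ge0 ?exprn_ge0 // ge_min lexx.
  by rewrite orbT.
rewrite [leLHS](_ : _ = C / (K * `|map_mx intr n : 'rV[R]_d|) ^+ m); last first.
  have aux (x a' b' : R) : x != 0 -> a' != 0 -> b' != 0 ->
    x * (C / (a' * x) / b') = C / (a' * b') by move=> *; field; apply/and3P.
  by rewrite exprMn aux // gt_eqF // ?exprn_gt0 // (lt_le_trans ltr01).
rewrite ler_wpM2l ?(ltW C0) // lef_pV2 ?posrE ?exprn_gt0 //.
  by rewrite lerXn2r // nnegrE // mulr_ge0 // ltW.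
by rewrite mulr_gt0 // (lt_le_trans ltr01).
Qed.

End Forms.

(** * Covering radius of a lattice without short vectors *)

Lemma pigeonhole_fiber (A B : finType) (f : A -> B) (t : nat) :
  (t * #|B| < #|A|)%N -> exists b, (t < #|[pred a | f a == b]|)%N.
Proof.
move=> h; apply: contrapT => nb; move: h; apply/negP; rewrite -leqNgt.
rewrite -[#|A|]sum1_card (partition_big f xpredT) //= mulnC -sum_nat_const.
apply: leq_sum => b _; rewrite sum1dep_card leqNgt.
by apply/negP => hb; apply: nb; exists b; rewrite -cardsE.
Qed.

Lemma truncn_eq_close (R : realType) (x y : R) :
  0 <= x -> 0 <= y -> Num.truncn x = Num.truncn y -> `|x - y| < 1.
Proof.
move=> /truncn_itv/andP[x1 x2] /truncn_itv/andP[y1 y2] xy.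
rewrite xy in x1 x2; rewrite -natr1 in x2 y2; rewrite ltr_norml.
by apply/andP; split; lra.
Qed.

Section LatticeCovering.
Variables (R : realType) (N : nat).

(* If the points lay on a hyperplane v.x = 0 with |v_j| maximal, their other
   N - 1 coordinates would still determine them up to a factor N, and the
   pigeonhole principle in N - 1 dimensions would produce two close points. *)
Lemma separated_row_full (A : finType) (w : A -> 'rV[R]_N) (T eps : R) (Q : nat) :
  0 < eps -> (forall a, `|w a| <= T) ->
  (forall a b, a != b -> eps <= `|w a - w b|) ->
  2 * T * N%:R / eps <= Q%:R -> (Q.+1 ^ N.-1 < #|A|)%N ->
  row_full (\matrix_(i < #|A|) w (enum_val i)).
Proof.
move=> e0 wT sep QT Acard.
set W := \matrix_i _.
have : row_free W^T; last first.
  by rewrite -row_leq_rank -col_leq_rank mxrank_tr.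
apply: inj_row_free => v vW; apply: contraTeq isT => v0.
have wv a : \sum_k v 0 k * w a 0 k = 0.
  have /matrixP/(_ 0 (enum_rank a)) := vW; rewrite !mxE => h; rewrite -[RHS]h.
  by apply: eq_bigr => k _; rewrite !mxE enum_rankK.
have [j0 _] := rV0Pn _ v0.
pose j := [arg max_(j > j0) `|v 0 j|]%O.
have vj k : `|v 0 k| <= `|v 0 j|.
  by rewrite /j; case: arg_maxP => //= i _ h; apply: h.
have vj0 : 0 < `|v 0 j|.
  have [k vk] := rV0Pn _ v0; apply: lt_le_trans (vj k).
  by rewrite normr_gt0.
have N0 : 0 < N%:R :> R by rewrite ltr0n (leq_ltn_trans _ (ltn_ord j0)).
(* Coordinates are counted in cells of side eps / N; adding T makes them nonnegative, and each index
   is at most Q. *)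
pose u a k := (w a 0 k + T) * (N%:R / eps).
have Ne0 : 0 < N%:R / eps by rewrite divr_gt0.
have u_ge0 a k : 0 <= u a k.
  rewrite mulr_ge0 ?(ltW Ne0) //.
  by have := le_trans (rV_coord_le _ k) (wT a); rewrite ler_norml => /andP[? ?]; lra.
have u_lt a k : (Num.truncn (u a k) < Q.+1)%N.
  rewrite ltnS truncn_le_nat; apply: (@le_lt_trans _ _ Q%:R); last by rewrite ltr_nat.
  apply: le_trans QT; rewrite /u mulrA ler_pM2r ?invr_gt0 // ler_pM2r //.
  by have := le_trans (rV_coord_le _ k) (wT a); rewrite ler_norml => /andP[? ?]; lra.
pose f a : {ffun 'I_N.-1 -> 'I_Q.+1} := [ffun k => Ordinal (u_lt a (lift j k))].
have [a [b [ab fab]]] : exists a b, a != b /\ f a = f b.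
  apply: contrapT => nf; have finj : injective f.
    move=> a b fab; apply: contrapT => /eqP ab.
    by apply: nf; exists a, b.
  by have := leq_card f finj; rewrite card_ffun !card_ord leqNgt Acard.
have close k : k != j -> `|w a 0 k - w b 0 k| < eps / N%:R.
  case: (unliftP j k) => [k' -> _|-> /eqP//].
  have /(congr1 (fun g : {ffun _} => nat_of_ord (g k'))) := fab.
  rewrite !ffunE /= => tE.
  have := truncn_eq_close (u_ge0 a (lift j k')) (u_ge0 b (lift j k')) tE.
  rewrite /u -mulrBl opprD addrACA subrr addr0 normrM (gtr0_norm Ne0).
  by rewrite -ltr_pdivlMr // mul1r invf_div.
suff : `|w a - w b| < eps by rewrite ltNge sep.
(* Since |v_j| is maximal, the hyperplane equation bounds the j-th difference by the sum of the
   other N - 1, each less than eps / N. *)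
have closej : `|w a 0 j - w b 0 j| < eps.
  have : v 0 j * (w a 0 j - w b 0 j) =
      - \sum_(k | k != j) v 0 k * (w a 0 k - w b 0 k).
    have : \sum_k v 0 k * (w a 0 k - w b 0 k) = 0.
      by under eq_bigr do rewrite mulrBr; rewrite sumrB !wv subr0.
    by rewrite (bigD1 j) //= => /eqP; rewrite addr_eq0 => /eqP.
  move=> /(congr1 Num.norm); rewrite normrM normrN => vE.
  rewrite -(ltr_pM2l vj0) vE; apply: le_lt_trans (ler_norm_sum _ _ _) _.
  apply: (@le_lt_trans _ _ (\sum_(k | k != j) `|v 0 j| * (eps / N%:R))).
    by apply: ler_sum => k kj; rewrite normrM ler_pM // ltW // close.
  rewrite sumr_const -mulrnAr ltr_pM2l // -[_ *+ _]mulr_natr -mulrA.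
  rewrite gtr_pMr // mulrC ltr_pdivrMr // mul1r ltr_nat.
  by rewrite -[X in (_ < X)%N]card_ord; apply/proper_card/properP; split;
    [apply/fintype.subsetP | exists j; rewrite // unfold_in eqxx].
have hall k : `|(w a - w b) 0 k| < eps.
  rewrite !mxE; have [->//|kj] := eqVneq k j.
  apply: lt_le_trans (close k kj) _; rewrite ler_pdivrMr // ler_peMr ?(ltW e0) //.
  by rewrite ler1n (leq_ltn_trans _ (ltn_ord j0)).
rewrite [`|w a - w b|]/Num.norm /= mx_normrE; apply/bigmax_ltP; split=> // -[i k] _.
by rewrite ord1.
Qed.

(** Some N of the vectors form a basis of R^N. Rounding down the coordinates of x in this basis
    gives a lattice point, and each basis vector contributes an error of at most T. *)
Lemma row_full_covering (g : {additive 'rV[int]_N -> 'rV[R]_N}) (A : finType)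
    (z : A -> 'rV[int]_N) (T : R) :
  (forall a, `|g (z a)| <= T) ->
  row_full (\matrix_(i < #|A|) g (z (enum_val i))) ->
  forall x, exists y, `|x - g y| <= N%:R * T.
Proof.
move=> gT Wfull x; set W := \matrix_i _ in Wfull.
pose f := fullrankfun Wfull; pose V := rowsub f W.
have Vu : V \in unitmx := fullrowsub_unit Wfull.
pose c := x *m invmx V.
exists (\sum_i z (enum_val (f i)) *~ Num.floor (c 0 i)).
have VE i : row i V = g (z (enum_val (f i))).
  by apply/rowP => k; rewrite !mxE.
rewrite raddf_sum -[x](mulmxKV Vu) -/c mulmx_sum_row -sumrB.
apply: le_trans (ler_norm_sum _ _ _) _.
rewrite mulr_natl -[X in _ *+ X]card_ord -sumr_const ler_sum // => i _.
rewrite VE raddfMz -scaler_int -scalerBl normrZ.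
have /andP[f1 f2] := floor_itv (c 0 i); rewrite intrD in f2.
apply: le_trans (gT (enum_val (f i))); rewrite ler_piMl // ler_norml.
by apply/andP; split; lra.
Qed.

(** Without short vectors, distinct lattice points are eps-separated, so a ball of radius T with
    more of them than a hyperplane section can hold contains a basis of the space. *)
Lemma lattice_covering (g : {additive 'rV[int]_N -> 'rV[R]_N}) (A : finType)
    (z : A -> 'rV[int]_N) (T eps : R) (Q : nat) :
  0 < eps -> (forall y, y != 0 -> eps <= `|g y|) ->
  injective z -> (forall a, `|g (z a)| <= T) ->
  2 * T * N%:R / eps <= Q%:R -> (Q.+1 ^ N.-1 < #|A|)%N ->
  forall x, exists y, `|x - g y| <= N%:R * T.
Proof.
move=> e0 gmin zinj gT QT Ac; apply: (row_full_covering gT).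
apply: (separated_row_full (w := g \o z) e0 gT _ QT Ac) => a b ab /=.
by rewrite -raddfB gmin // subr_eq0 (inj_eq zinj).
Qed.

End LatticeCovering.

(** The inverse of 1 plus the sum of the inverses works, also for an empty [I]. *)
Lemma pos_lower_bound (R : realType) (I : finType) (F : I -> R) :
  (forall i, 0 < F i) -> exists2 e : R, 0 < e <= 1 & forall i, e <= F i.
Proof.
move=> F0; have s0 (P : pred I) : 0 <= \sum_(i | P i) (F i)^-1.
  by apply: sumr_ge0 => i _; rewrite invr_ge0 ltW.
have s1 : 0 < 1 + \sum_i (F i)^-1 by rewrite ltr_pwDl.
exists (1 + \sum_i (F i)^-1)^-1.
  by rewrite invr_gt0 s1 invf_le1 // lerDl s0.
move=> i; rewrite -[leRHS]invrK lef_pV2 ?posrE ?invr_gt0 //.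
by rewrite (bigD1 i) //= addrCA lerDl addr_ge0 ?s0.
Qed.

(** * A rescaled lattice attached to the linear forms *)

Section Covering.
Variables (R : realType) (d c : nat) (L : 'I_c -> {scalar 'rV[R]_d}).
Variable m : 'I_c -> nat.

Definition rescaled (X : R) (y : 'rV[int]_(d + c)) : 'rV[R]_(d + c) :=
  row_mx (X^-1 *: map_mx intr (lsubmx y))
    (\row_i (X ^+ m i * (int_form (L i) (lsubmx y) - (rsubmx y 0 i)%:~R))).

Lemma rescaled_is_zmod_morphism X : zmod_morphism (rescaled X).
Proof.
move=> a b; rewrite /rescaled !linearB opp_row_mx add_row_mx map_mxB /= scalerBr.
congr row_mx; apply/rowP => i; rewrite !mxE raddfB intrB -mulrBr.
by congr (_ * _); rewrite !opprB !addrA addrAC [RHS]addrAC; congr (_ + _);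
  rewrite [RHS]addrAC.
Qed.

HB.instance Definition _ X := GRing.isZmodMorphism.Build _ _ (rescaled X)
  (rescaled_is_zmod_morphism X).

(** A vector of norm less than e <= 1 has |n| <= X. If n lies outside some kernel, bad
    approximability makes the corresponding coordinate at least C_i; otherwise n = 0, and a nonzero
    p_i contributes at least 1. *)
Lemma rescaled_lower_bound :
  (forall i, exists2 C : R, 0 < C & forall n, n \notin ker_mod1 (L i) ->
     C / `|map_mx intr n : 'rV[R]_d| ^+ m i <= dist_int (int_form (L i) n)) ->
  (forall n, (forall i, n \in ker_mod1 (L i)) -> n = 0) ->
  exists2 e : R, 0 < e <= 1 &
    forall X y, 1 <= X -> y != 0 -> e <= `|rescaled X y|.
Proof.
move=> /(_ _)/cid2-/all_sig2[C C0 CP] ker0.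
have [e /andP[e0 e1] eC] := pos_lower_bound C0.
exists e; rewrite ?e0 // => X y X1 y0; rewrite leNgt; apply/negP => lt.
have X0 : 0 < X by apply: lt_le_trans X1.
set n := lsubmx y; set p := rsubmx y.
have pP i : X ^+ m i * `|int_form (L i) n - (p 0 i)%:~R| < e.
  apply: le_lt_trans lt; have := rV_coord_le (rescaled X y) (rshift d i).
  by rewrite row_mxEr mxE normrM ger0_norm // exprn_ge0 // ltW.
have nP : `|map_mx intr n : 'rV[R]_d| <= X.
  apply/rV_norm_leP => [|k]; first exact: ltW.
  have := le_lt_trans (rV_coord_le (rescaled X y) (lshift c k)) lt.
  rewrite row_mxEl mxE normrM gtr0_norm ?invr_gt0 // ltr_pdivrMl // => h.
  by apply: ltW (lt_le_trans h _); rewrite ler_piMr // ltW.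
have [nS|] := pselect (forall i, n \in ker_mod1 (L i)); last first.
  move=> /existsNP[i /negP nSi].
  have n1 : 1 <= `|map_mx intr n : 'rV[R]_d|.
    apply: intV_norm_ge1; apply: contra nSi => /eqP ->.
    by have [] := ker_mod1_zmod_closed (L i).
  have := lt_le_trans (pP i) (eC i); apply/negP; rewrite -leNgt.
  rewrite -ler_pdivrMl ?exprn_gt0 //; apply: le_trans (dist_int_le _ _).
  apply: le_trans (CP i n nSi); rewrite mulrC ler_pM2l //.
  rewrite lef_pV2 ?posrE ?exprn_gt0 // ?(lt_le_trans ltr01) //.
  by rewrite lerXn2r ?nnegrE ?normr_ge0 ?(ltW X0).
have n0 := ker0 n nS; have p0 : p != 0.
  apply: contra y0 => /eqP p0; rewrite -[y]hsubmxK -/n -/p n0 p0.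
  by rewrite row_mx0.
have [i pi] := rV0Pn _ p0.
have := lt_le_trans (pP i) e1; apply/negP; rewrite -leNgt n0 raddf0 sub0r normrN.
rewrite mulr_ege1 // ?exprn_ege1 //.
by rewrite -intr_norm ler1z -gtz0_ge1 normr_gt0.
Qed.

(** Dirichlet's box principle: among the n with entries in [0, T X], many have the fractional parts
    of all L_i(n) in the same bins, and their differences from a fixed one of them are the required
    points. *)
Lemma rescaled_points (T X : R) (t : nat) :
  1 <= T -> T <= X -> (forall i, 0 < m i)%N -> (\sum_i m i = d)%N ->
  t%:R * 2 ^+ c < T ^+ (d + c) ->
  exists A : finType, exists z : A -> 'rV[int]_(d + c),
    [/\ (t < #|A|)%N, injective z & forall a, `|rescaled X (z a)| <= T].
Proof.
move=> T1 TX m0 sm tT.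
have T0 : 0 < T by apply: lt_le_trans T1.
have X0 : 0 < X by apply: lt_le_trans TX.
have X1 : 1 <= X by apply: le_trans TX.
set W := (Num.truncn (T * X)).+1.
have Wgt : T * X < W%:R by apply: truncnS_gt.
have Wle (k : 'I_W) : k%:R <= T * X.
  by rewrite -truncn_ge_nat ?(mulr_ge0 (ltW T0) (ltW X0)) // -ltnS.
(* The unit interval is cut into at most q_i + 1 bins of length T / X^(m_i). Since T <= X and m_i >
   0, the ratio X^(m_i) / T is at least 1, which gives q_i + 1 <= 2 X^(m_i) / T. *)
pose q i := Num.truncn (X ^+ m i / T).
have XmT i : 1 <= X ^+ m i / T.
  rewrite ler_pdivlMr // mul1r (le_trans TX) // -[leLHS]expr1.
  by rewrite ler_weXn2l.
have qle i : (q i).+1%:R <= 2 / T * X ^+ m i.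
  have : (q i)%:R <= X ^+ m i / T by rewrite truncn_le (le_trans ler01).
  by rewrite -natr1 => h; have := XmT i; rewrite mulrAC -mulrA; lra.
pose A0 : finType := {ffun 'I_d -> 'I_W}.
pose pt (a : A0) : 'rV[int]_d := \row_j (a j : nat)%:Z.
pose fr i (a : A0) := int_form (L i) (pt a) - (Num.floor (int_form (L i) (pt a)))%:~R.
have frP i a : 0 <= fr i a < 1.
  have /andP[h1 h2] := floor_itv (int_form (L i) (pt a)); rewrite intrD in h2.
  by rewrite /fr; apply/andP; split; lra.
have fr0 i a : 0 <= fr i a * (X ^+ m i / T).
  have /andP[h _] := frP i a.
  by rewrite mulr_ge0 // (le_trans ler01).
have frq i a : (Num.truncn (fr i a * (X ^+ m i / T)) < (q i).+1)%N.
  rewrite ltnS le_truncn // ler_piMl ?(le_trans ler01) //.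
  by have /andP[_ /ltW] := frP i a.
pose f (a : A0) : {dffun forall i : 'I_c, 'I_(q i).+1} :=
  [ffun i => Ordinal (frq i a)].
have [|b bP] := @pigeonhole_fiber _ _ f t.
  rewrite card_ffun !card_ord card_dep_ffun -(ltr_nat R) natrM natrX.
  rewrite foldrE big_image /=; under eq_bigr do rewrite card_ord.
  rewrite natr_prod.
  (* As the m_i add up to d, there are at most (2 / T)^c X^d bins, against more than (T X)^d
     points. *)
  apply: (@le_lt_trans _ _ (t%:R * \prod_(i < c) (2 / T * X ^+ m i))).
    rewrite ler_wpM2l // ler_prod // => i _.
    by rewrite qle andbT.
  apply: (@lt_le_trans _ _ ((T * X) ^+ d)); last first.
    by rewrite lerXn2r ?nnegrE ?(mulr_ge0 (ltW T0) (ltW X0)) ?(ltW Wgt).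
  rewrite big_split /= prodr_const card_ord prodrXr sm (exprMn d T X) mulrA.
  rewrite ltr_pM2r ?exprn_gt0 // exprMn exprVn mulrA ltr_pdivrMr ?exprn_gt0 //.
  by rewrite -exprD.
have /card_gt0P[a0 /eqP a0b] : (0 < #|[pred a | f a == b]|)%N by apply: leq_ltn_trans bP.
pose A : finType := {a : A0 | f a == b}.
pose z (a : A) : 'rV[int]_(d + c) := row_mx (pt (val a) - pt a0)
  (\row_i (Num.floor (int_form (L i) (pt (val a))) -
           Num.floor (int_form (L i) (pt a0)))).
exists A, z; split.
- by rewrite card_sig.
- move=> a a' /(congr1 lsubmx); rewrite !row_mxKl => /addIr /rowP e.
  apply: val_inj; apply/ffunP => j; apply: val_inj.
  by have := e j; rewrite !mxE => -[].
move=> a; apply/rV_norm_leP => [|k]; first exact: ltW.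
have fa : f (val a) = f a0 by rewrite a0b; apply/eqP/(valP a).
case: (split_ordP k) => j ->;
  rewrite /rescaled ?row_mxEl ?row_mxEr /z row_mxKl ?row_mxKr !mxE.
  rewrite normrM gtr0_norm ?invr_gt0 // ler_pdivrMl // mulrC.
  have h1 := Wle (val a j); have h2 := Wle (a0 j).
  have h3 : 0 <= (val a j)%:R :> R by [].
  have h4 : 0 <= (a0 j)%:R :> R by [].
  by rewrite ler_norml intrB; apply/andP; split; lra.
have /(congr1 (fun g : {dffun forall i : 'I_c, 'I_(q i).+1} => nat_of_ord (g j))) := fa.
rewrite !ffunE /= => /(truncn_eq_close (fr0 _ _) (fr0 _ _)).
rewrite -mulrBl normrM (@ger0_norm _ (X ^+ m j / T)) ?(le_trans ler01) //.
rewrite (raddfB (int_form (L j))) intrB mulrA ltr_pdivrMr // mul1r mulrC => /ltW.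
rewrite /fr normrM (@ger0_norm _ (X ^+ m j)) ?exprn_ge0 ?(ltW X0) //.
move=> /(le_trans _); apply; rewrite le_eqVlt; apply/orP; left.
by apply/eqP; congr (_ * `|_|); ring.
Qed.

End Covering.

(** * Sufficiency: from bad approximability to repetitivity *)

Section Repetitive.
Variables (R : realType) (d c : nat) (L : 'I_c -> {scalar 'rV[R]_d}).

(** The covering radius of the rescaled lattice is bounded uniformly in X. Applying this to the
    target (n0 / X, X^(m_i) t_i) and undoing the scaling gives an inhomogeneous approximation
    theorem. *)
Lemma simultaneous_covering (m : 'I_c -> nat) (e : R) :
  0 < e <= 1 -> (0 < d)%N -> (forall i, 0 < m i)%N -> (\sum_i m i = d)%N ->
  (forall X y, 1 <= X -> y != 0 -> e <= `|rescaled L m X y|) ->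
  exists2 K : R, 0 < K &
    forall X (n0 : 'rV[int]_d) (t : 'I_c -> R), 1 <= X ->
    exists n (p : 'I_c -> int),
      `|map_mx intr n - map_mx intr n0 : 'rV[R]_d| <= K * X /\
      forall i, `|int_form (L i) n - (p i)%:~R - t i| <= K / X ^+ m i.
Proof.
move=> /andP[e0 e1] d0 m0 sm emin.
pose N := (d + c)%N; have N0 : (0 < N)%N by rewrite addn_gt0 d0.
have N1 : 1 <= N%:R :> R by rewrite ler1n.
have N0' : 0 < N%:R :> R by rewrite ltr0n.
(* The box principle must yield more than (Q + 1)^(N - 1) points, with Q about 2 T N / e. This
   follows from 2^c (4 T N / e)^(N - 1) < T^N, that is, from 2^c (4 N / e)^(N - 1) < T. *)
pose T : R := 1 + 2 ^+ c * (4 * N%:R / e) ^+ N.-1.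
have q0 : 0 <= 2 ^+ c * (4 * N%:R / e) ^+ N.-1.
  by rewrite mulr_ge0 ?exprn_ge0 // divr_ge0 ?mulr_ge0 // ltW.
have T1 : 1 <= T by rewrite lerDl.
have T0 : 0 < T by apply: lt_le_trans T1.
have TN1 : 1 <= T * N%:R / e.
  by rewrite ler_pdivlMr // mul1r (le_trans e1) // mulr_ege1.
pose Q := (Num.truncn (2 * T * N%:R / e)).+1.
have Qge : 2 * T * N%:R / e <= Q%:R by apply/ltW/truncnS_gt.
have Qle : Q.+1%:R <= 4 * T * N%:R / e.
  have : (Num.truncn (2 * T * N%:R / e))%:R <= 2 * T * N%:R / e.
    by rewrite truncn_le divr_ge0 ?mulr_ge0 // ltW.
  move: TN1; rewrite /Q -!natr1 -!mulrA; set u := T * _; set v := (_)%:R; lra.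
have tT : (Q.+1 ^ N.-1)%:R * 2 ^+ c < T ^+ N.
  apply: (@le_lt_trans _ _ ((4 * T * N%:R / e) ^+ N.-1 * 2 ^+ c)).
    rewrite ler_wpM2r ?exprn_ge0 // natrX lerXn2r ?nnegrE //.
    by rewrite divr_ge0 ?mulr_ge0 // ltW.
  rewrite -(mulrA 4) (mulrCA 4) -!mulrA (exprMn _ T) -mulrA -[in ltRHS](prednK N0).
  rewrite exprSr ltr_pM2l ?exprn_gt0 // mulrC [in ltRHS]/T !mulrA.
  by rewrite ltrDr.
exists (N%:R * T * T) => [|X n0 t X1]; first by rewrite !mulr_gt0.
(* [rescaled_points] asks for a scale of at least T; as X >= 1, raising X to it costs at most a
   factor T. *)
pose X' := Num.max X T.
have TX' : T <= X' by rewrite le_max lexx orbT.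
have XX' : X <= X' by rewrite le_max lexx.
have X'0 : 0 < X' by apply: lt_le_trans TX'.
have X0 : 0 < X by apply: lt_le_trans X1.
have X'1 : 1 <= X' by apply: le_trans XX'.
have X'le : X' <= T * X by rewrite ge_max ler_peMl ?ler_peMr // ltW.
have [A [z [cA zinj zT]]] := rescaled_points L T1 TX' m0 sm tT.
have [y yP] := lattice_covering e0 (fun y => emin X' y X'1) zinj zT Qge cA
  (row_mx (X'^-1 *: map_mx intr n0) (\row_i (X' ^+ m i * t i))).
have NT0 : 0 < N%:R * T by rewrite mulr_gt0.
exists (lsubmx y), (fun i => rsubmx y 0 i); split=> [|i].
  apply/rV_norm_leP => [|k]; first by rewrite !mulr_ge0 // ltW.
  have := le_trans (rV_coord_le _ (lshift c k)) yP.
  rewrite /rescaled /= opp_row_mx add_row_mx row_mxEl !mxE -mulrBr normrM.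
  rewrite gtr0_norm ?invr_gt0 // ler_pdivrMl // distrC mulrC => /le_trans -> //.
  by rewrite -[leRHS]mulrA ler_pM2l.
have := le_trans (rV_coord_le _ (rshift d i)) yP.
rewrite /rescaled /= opp_row_mx add_row_mx row_mxEr !mxE -mulrBr normrM.
rewrite gtr0_norm ?exprn_gt0 // -ler_pdivlMl ?exprn_gt0 // distrC => /le_trans -> //.
rewrite mulrC; apply: (@le_trans _ _ (N%:R * T / X ^+ m i)).
  rewrite ler_pM2l // lef_pV2 ?posrE ?exprn_gt0 //.
  by rewrite lerXn2r ?nnegrE ?(ltW X0) ?(ltW X'0).
by rewrite ler_pM2r ?invr_gt0 ?exprn_gt0 // ler_peMr // ltW.
Qed.

(* The interval around [phi] delimited by the points of [l n + Z], [|n| <= r],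
   is not short, because any two of these points differ by an element of
   [l (n - n') + Z]; the witness is its midpoint. *)
Lemma cell_center (l : {scalar 'rV[R]_d}) (m : nat) (C r phi : R) :
  0 < C <= 1 -> 1 <= r ->
  (forall n, n \notin ker_mod1 l ->
     C / `|map_mx intr n : 'rV[R]_d| ^+ m <= dist_int (int_form l n)) ->
  exists tau, forall phi', `|phi' - tau| < C / (2 * r) ^+ m / 2 ->
    forall n, `|map_mx intr n : 'rV[R]_d| <= r ->
    Num.floor (phi' - int_form l n) = Num.floor (phi - int_form l n).
Proof.
move=> /andP[C0 C1] r1 CP; set H := C / (2 * r) ^+ m.
have r0 : 0 < r by apply: lt_le_trans r1.
have r2 : 1 <= (2 * r) ^+ m by apply: exprn_ege1; lra.
(* The last point of l n + Z up to phi: the cell of phi runs from the largest [a n] to the smallest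
   [a n + 1]. *)
pose a n := int_form l n + (Num.floor (phi - int_form l n))%:~R.
have aP n : a n <= phi < a n + 1.
  have /andP[f1 f2] := floor_itv (phi - int_form l n); rewrite intrD in f2.
  by rewrite /a; apply/andP; split; lra.
have aH n n' : `|map_mx intr n : 'rV[R]_d| <= r ->
    `|map_mx intr n' : 'rV[R]_d| <= r -> a n' + H <= a n + 1.
  move=> nr nr'.
  have /andP[_ lt] := aP n; have /andP[le _] := aP n'.
  have {lt le} gt0 : 0 < a n + 1 - a n' by lra.
  have aE : a n + 1 - a n' = int_form l (n - n') -
      (Num.floor (phi - int_form l n') - Num.floor (phi - int_form l n) - 1)%:~R.
    by rewrite /a raddfB !intrB; ring.
  (* When n - n' is in the kernel, the positive gap is an integer, hence at least 1, and H <= 1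
     because C <= 1. *)
  rewrite addrC -lerBrDr; have [nS|nS] := boolP (n - n' \in ker_mod1 l).
    apply: (@le_trans _ _ 1).
      by rewrite ler_pdivrMr ?mul1r ?(lt_le_trans ltr01) // (le_trans C1).
    move: gt0; rewrite aE; move: nS; rewrite ker_mod1E => /intrP[z ->].
    by rewrite -intrB ltr0z ler1z gtz0_ge1.
  rewrite -[leRHS]gtr0_norm // aE; apply: le_trans (dist_int_le _ _).
  apply: le_trans (CP _ nS); rewrite ler_pM2l // lef_pV2 ?posrE.
  - rewrite lerXn2r ?nnegrE ?mulr_ge0 ?(ltW r0) //.
    by rewrite map_mxB (le_trans (ler_normB _ _)) // mulr_natl mulr2n lerD.
  - by rewrite (lt_le_trans ltr01).
  - rewrite exprn_gt0 // (lt_le_trans ltr01) // intV_norm_ge1 //.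
    by apply: contra nS => /eqP ->; have [] := ker_mod1_zmod_closed l.
pose E := [set a n | n in [set n | `|map_mx intr n : 'rV[R]_d| <= r]].
have E0 : E !=set0.
  by exists (a 0), 0 => //=; rewrite map_mx0 normr0 ltW.
have Eub n : `|map_mx intr n : 'rV[R]_d| <= r -> a n <= sup E.
  move=> nr; apply: ub_le_sup; last by exists n.
  by exists phi => _ [k _ <-]; have /andP[] := aP k.
have Ele n : `|map_mx intr n : 'rV[R]_d| <= r -> sup E + H <= a n + 1.
  move=> nr; rewrite -lerBrDr; apply: ge_sup => // _ [k kr <-].
  by rewrite lerBrDr aH.
exists (sup E + H / 2) => phi'; rewrite ltr_norml => /andP[lo hi] n nr.
have := Eub n nr; have := Ele n nr; rewrite {1 2}/a => h1 h2.
by apply: floor_def; rewrite intrD; apply/andP; split; lra.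
Qed.

(** For theta the offset of the strip, these floor differences are, up to sign, the last c
    coordinates of the lattice vector joining the strip points above n and n + k. *)
Definition same_pattern (theta : 'I_c -> R) (r : R) (n n' : 'rV[int]_d) : Prop :=
  forall k i, `|map_mx intr k : 'rV[R]_d| <= r ->
    Num.floor (theta i - int_form (L i) (n' + k)) -
    Num.floor (theta i - int_form (L i) n') =
    Num.floor (theta i - int_form (L i) (n + k)) -
    Num.floor (theta i - int_form (L i) n).

Definition lattice_repetitive (theta : 'I_c -> R) : Prop :=
  exists2 C : R, 0 < C & forall r (n n0 : 'rV[int]_d), 1 <= r ->
    exists2 n', `|map_mx intr n' - map_mx intr n0 : 'rV[R]_d| <= C * r &
      same_pattern theta r n n'.

(** The cell of size r around theta_i - L_i(n) has length at least D / (2 r)^(m_i). Approximation at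
    scale A r, with A large, is precise enough to hit the middle of all c cells simultaneously. *)
Lemma lattice_repetitive_bad_approx (m : 'I_c -> nat) (theta : 'I_c -> R) :
  (0 < d)%N -> (forall i, 0 < m i)%N -> (\sum_i m i = d)%N ->
  (forall i, exists2 C : R, 0 < C & forall n, n \notin ker_mod1 (L i) ->
     C / `|map_mx intr n : 'rV[R]_d| ^+ m i <= dist_int (int_form (L i) n)) ->
  (forall n, (forall i, n \in ker_mod1 (L i)) -> n = 0) ->
  lattice_repetitive theta.
Proof.
move=> d0 m0 sm ba ker0.
have [e eP emin] := rescaled_lower_bound ba ker0.
have [K K0 KP] := simultaneous_covering eP d0 m0 sm emin.
have /all_sig2[C C0 CP] := fun i => cid2 (ba i).
have [D /andP[D0 D1] DC] := pos_lower_bound C0.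
(* This makes K / (A r)^(m_i) smaller than half of D / (2 r)^(m_i): as 1 <= m_i <= d, one has
   A^(m_i) >= A and 2^(m_i + 1) <= 2^(d + 1). *)
pose A := 1 + 2 ^+ d.+1 * K / D.
have A1 : 1 <= A by rewrite lerDl divr_ge0 ?mulr_ge0 ?exprn_ge0 ?(ltW K0) ?(ltW D0).
have A0 : 0 < A by apply: lt_le_trans A1.
have Abig : 2 ^+ d.+1 * K / D < A by rewrite ltrDr.
exists (K * A) => [|r n n0 r1]; first by rewrite mulr_gt0.
have r0 : 0 < r by apply: lt_le_trans r1.
have /(_ _)/cid -/all_sig[tau tauP] i :
    exists tau, forall phi', `|phi' - tau| < D / (2 * r) ^+ m i / 2 ->
    forall k, `|map_mx intr k : 'rV[R]_d| <= r ->
    Num.floor (phi' - int_form (L i) k) =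
    Num.floor (theta i - int_form (L i) n - int_form (L i) k).
  apply: cell_center => //; first by rewrite D0.
  move=> k kS; apply: le_trans (CP i k kS).
  by rewrite ler_wpM2r ?invr_ge0 ?exprn_ge0 ?DC.
(* Bringing L_i(n') close to theta_i - tau_i modulo 1 puts theta_i - L_i(n') close to the centre
   tau_i modulo 1. *)
have [|n' [p [n'P pP]]] := KP (A * r) n0 (fun i => theta i - tau i).
  by rewrite mulr_ege1.
exists n' => [|k i kr]; first by rewrite -mulrA.
have md : (m i <= d)%N by rewrite -sm (bigD1 i) //= leq_addr.
have close : `|theta i - int_form (L i) n' + (p i)%:~R - tau i| <
    D / (2 * r) ^+ m i / 2.
  rewrite (_ : _ - _ = - (int_form (L i) n' - (p i)%:~R - (theta i - tau i))); last by ring.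
  rewrite normrN; apply: le_lt_trans (pP i) _.
  rewrite !exprMn (_ : K / _ = K / A ^+ m i / r ^+ m i); last by rewrite invfM mulrA.
  rewrite (_ : _ / 2 = D / 2 ^+ (m i).+1 / r ^+ m i); last first.
    by rewrite exprSr !invfM !mulrA [RHS]mulrAC.
  rewrite ltr_pM2r ?invr_gt0 ?exprn_gt0 // ltr_pdivlMr ?exprn_gt0 //.
  apply: (@le_lt_trans _ _ (K / A * 2 ^+ d.+1)).
    apply: ler_pM; rewrite ?divr_ge0 ?exprn_ge0 ?(ltW K0) ?(ltW A0) //.
      rewrite ler_pM2l // lef_pV2 ?posrE ?exprn_gt0 //.
      by rewrite -[leLHS]expr1 ler_weXn2l.
    by rewrite ler_weXn2l // ?ler1n // ltnS.
  rewrite mulrAC ltr_pdivrMr //.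
  by move: Abig; rewrite ltr_pdivrMr // mulrC (mulrC A).
have fl q : `|map_mx intr q : 'rV[R]_d| <= r ->
    Num.floor (theta i - int_form (L i) (n' + q)) =
    Num.floor (theta i - int_form (L i) (n + q)) - p i.
  move=> qr; have := tauP i _ close q qr.
  rewrite !int_formD !opprD !addrA => <-.
  rewrite (_ : _ + _%:~R - _ = theta i - int_form (L i) n' -
    int_form (L i) q + (p i)%:~R); last by ring.
  by rewrite (floorDrz _ (intr_int _ (p i))) intrKfloor addrK.
have := fl 0; rewrite !addr0 map_mx0 normr0 => /(_ (ltW r0)) ->.
by rewrite fl //; ring.
Qed.

End Repetitive.

(** * Counting patterns *)

(** Adding w + t makes the argument of [absz] positive, so the natural number determines u - v;
    positions can thus be stored in an ordinal. *)
Lemma shifted_box_inj (u u' v v' : int) (t w y y' : nat) :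
  (absz v < t)%N -> (absz v' < t)%N ->
  (absz (u - y%:Z)%R <= w)%N -> (absz (u' - y'%:Z)%R <= w)%N ->
  absz (u - v + w%:Z + t%:Z) = absz (u' - v' + w%:Z + t%:Z) -> u - v = u' - v'.
Proof. by lia. Qed.

Lemma box_inj (u : int) (w z z' : nat) :
  (absz (u - ((2 * w + 1) * z)%N%:Z)%R <= w)%N ->
  (absz (u - ((2 * w + 1) * z')%N%:Z)%R <= w)%N -> z = z'.
Proof.
move=> h1 h2; have [lt|lt|//] := ltngtP z z'.
  have : ((2 * w + 1) * z.+1 <= (2 * w + 1) * z')%N by rewrite leq_mul2l lt orbT.
  by rewrite mulnS; move: h1 h2; move: (_ * z)%N (_ * z')%N => a b; lia.
have : ((2 * w + 1) * z'.+1 <= (2 * w + 1) * z)%N by rewrite leq_mul2l lt orbT.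
by rewrite mulnS; move: h1 h2; move: (_ * z)%N (_ * z')%N => a b; lia.
Qed.

Lemma shifted_box_lt (u v : int) (t w z : nat) :
  (absz v < t)%N -> (absz (u - ((2 * w + 1) * z)%N%:Z)%R <= w)%N ->
  ((2 * w + 1) * z.+1 <= (2 * w + 1) * t)%N ->
  (absz (u - v + w%:Z + t%:Z)%R < t * (2 * w + 3))%N.
Proof.
have -> : (t * (2 * w + 3) = 2 * (w * t) + 3 * t)%N by lia.
have -> : ((2 * w + 1) * t = 2 * (w * t) + t)%N by lia.
by rewrite mulnS; move: (w * t)%N (_ * z)%N => a Y; lia.
Qed.

Section Counting.
Variables (R : realType) (d c : nat) (L : 'I_c -> {scalar 'rV[R]_d}).
Variable theta : 'I_c -> R.

(* The points representing the patterns of [A] are found in [t ^ d] disjoint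
   boxes of side [2 w + 1]; [t] is so large that the shifts [q] do not move
   them far in comparison. *)
Lemma pattern_shift_count (r : R) (w : nat) (A B : finType) (pt : A -> 'rV[int]_d)
    (q : B -> 'rV[int]_d) :
  (forall n n0 : 'rV[int]_d, exists2 n',
     `|map_mx intr n' - map_mx intr n0 : 'rV[R]_d| <= w%:R &
     same_pattern L theta r n n') ->
  (forall a b n, same_pattern L theta r (pt a) n ->
     same_pattern L theta r (pt b) n -> a = b) ->
  (forall a b i j n n', same_pattern L theta r (pt a) n ->
     same_pattern L theta r (pt b) n' -> n - q i = n' - q j -> i = j) ->
  (#|B| * #|A| <= (2 * w + 3) ^ d)%N.
Proof.
move=> rep ptinj qinj.
pose t := (\sum_i \sum_k absz (q i 0%R k))%N.+1.
have qt i k : (absz (q i 0%R k) < t)%N.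
  by rewrite ltnS (bigD1 i) //= (bigD1 k) //= -addnA leq_addr.
pose box (b : {ffun 'I_d -> 'I_t}) : 'rV[int]_d := \row_k (((2 * w + 1) * b k)%N : int).
have /(_ _)/cid2-/all_sig2[h hbox hpat] := fun ab => rep (pt ab.1) (box ab.2).
have hb a b k : (absz (h (a, b) 0 k - ((2 * w + 1) * b k)%N%:Z)%R <= w)%N.
  have := le_trans (rV_coord_le _ k) (hbox (a, b)).
  by rewrite !mxE /= -intrB -intr_norm -[w%:R]/((w%:Z)%:~R) ler_int -lez_nat abszE.
pose s := (t * (2 * w + 3))%N.
have lt (x : B * (A * {ffun 'I_d -> 'I_t})) k :
    (absz ((h x.2 - q x.1) 0 k + w%:Z + t%:Z)%R < s)%N.
  have := hb x.2.1 x.2.2 k; have := qt x.1 k; have := ltn_ord (x.2.2 k).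
  rewrite -surjective_pairing !mxE /s.
  move: (h _ _ _) (q _ _ _) (nat_of_ord _) => u v z zt vt hu.
  have : ((2 * w + 1) * z.+1 <= (2 * w + 1) * t)%N by rewrite leq_mul2l zt orbT.
  exact: shifted_box_lt vt hu.
(* A triple of a shift, a pattern and a box is recorded by the shifted point. Comparing the |B| |A|
   t^d triples with the s^d positions, the factor t^d cancels. *)
pose F x : {ffun 'I_d -> 'I_s} := [ffun k => Ordinal (lt x k)].
have Finj : injective F.
  move=> [i [a b]] [j [a' b']] FE.
  have e : h (a, b) - q i = h (a', b') - q j.
    apply/rowP => k.
    have /(congr1 (fun g : {ffun _} => nat_of_ord (g k))) := FE.
    rewrite !ffunE /= => e.
    move: e; rewrite !mxE.
    exact: shifted_box_inj (qt i k) (qt j k) (hb a b k) (hb a' b' k).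
  have ij := qinj _ _ _ _ _ _ (hpat (a, b)) (hpat (a', b')) e.
  rewrite ij in e *; have {}e := addIr _ e.
  have aa : a = a'.
    by apply: (ptinj _ _ (h (a, b)) (hpat (a, b))); rewrite e; apply: hpat.
  rewrite -aa in e *; do 2 congr (_, _); apply/ffunP => k; apply: val_inj => /=.
  by have := hb a b k; rewrite e => /box_inj; apply; apply: hb.
have := leq_card F Finj; rewrite !card_prod !card_ffun !card_ord /s expnMn mulnA.
by rewrite [X in (_ <= X)%N]mulnC leq_pmul2r // expn_gt0.
Qed.

(** The trace of total irrationality on the transversal torus R^c / Z^c. *)
Definition dense_mod1 : Prop :=
  forall (t : 'I_c -> R) (e : R), 0 < e -> exists n (p : 'I_c -> int),
    forall i, `|int_form (L i) n + (p i)%:~R - t i| < e.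

(* [pp a i] is the integer that brings [theta i - L_i (pt a)] into [0, 1),
   just above the fractional part of [L_i (f i (a i))]. *)
Lemma separated_patterns (T : 'I_c -> finType) (f : forall i, T i -> 'rV[int]_d)
    (r delta : R) :
  dense_mod1 -> 0 < delta ->
  (forall i a, `|map_mx intr (f i a) : 'rV[R]_d| <= r) ->
  (forall i a b, f i a - f i b \in ker_mod1 (L i) -> a = b) ->
  exists (pt : {dffun forall i, T i} -> 'rV[int]_d)
    (pp : {dffun forall i, T i} -> 'I_c -> int),
    (forall a b n, same_pattern L theta r (pt a) n ->
       same_pattern L theta r (pt b) n -> a = b) /\
    forall (a : {dffun forall i, T i}) i, let x := int_form (L i) (f i (a i)) in
      0 <= theta i - int_form (L i) (pt a) + (pp a i)%:~R - (x - (Num.floor x)%:~R)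
        < delta.
Proof.
move=> dens delta0 fr finj.
pose x i a := int_form (L i) (f i a) - (Num.floor (int_form (L i) (f i a)))%:~R.
have xP i a : 0 <= x i a < 1.
  have /andP[h1 h2] := floor_itv (int_form (L i) (f i a)); rewrite intrD in h2.
  by rewrite /x; apply/andP; split; lra.
have xinj i a b : x i a = x i b -> a = b.
  move=> xab; apply: finj; rewrite ker_mod1E raddfB.
  rewrite (_ : _ - _ = (Num.floor (int_form (L i) (f i a)) -
    Num.floor (int_form (L i) (f i b)))%:~R) ?intr_int //.
  by move: xab; rewrite /x intrB => xab; lra.
pose I : finType := {i : 'I_c & (T i * T i)%type}.
(* For each i, a common lower bound eta makes the intervals [x, x + eta) at the values x disjoint,
   contained in [0, 1) and no longer than delta. *)
pose G (y : I) := let: existT i ab := y in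
  Num.min delta (Num.min (1 - x i ab.1) (if ab.1 == ab.2 then 1 else
    `|x i ab.1 - x i ab.2|)).
have [|eta /andP[eta0 eta1] etaG] := @pos_lower_bound _ _ G.
  move=> [i [a b]] /=; rewrite !lt_min delta0 subr_gt0.
  have /andP[_ ->] := xP i a; case: eqP => [_|ab]; first by rewrite ltr01.
  by rewrite normr_gt0 subr_eq0; apply/eqP => /xinj.
have etaD (i : 'I_c) (a b : T i) : [/\ eta <= delta, eta <= 1 - x i a &
    a != b -> eta <= `|x i a - x i b|].
  have := etaG (existT _ i (a, b)); rewrite /= !le_min => /and3P[-> -> h].
  by split=> // /negPf ab; rewrite ab in h.
have /(_ _)/cid -/all_sig[np npP] (a : {dffun forall i, T i}) :
    exists np : 'rV[int]_d * ('I_c -> int), forall i,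
      x i (a i) <= theta i - int_form (L i) np.1 + (np.2 i)%:~R < x i (a i) + eta.
  (* The target puts theta_i - L_i(n), modulo 1, at the midpoint of [x, x + eta). *)
  have [|n [p npP]] := dens (fun i => theta i - x i (a i) - eta / 2) (eta / 2).
    by rewrite divr_gt0.
  exists (n, fun i => - p i) => i /=; have := npP i; rewrite ltr_norml intrN.
  by move=> /andP[h1 h2]; apply/andP; split; lra.
exists (fun a => (np a).1), (fun a => (np a).2); split; last first.
  move=> a i; have /andP[h1 h2] := npP a i; have [h3 _ _] := etaD i (a i) (a i).
  by move: h1 h2; rewrite /x /= => h1 h2; apply/andP; split; lra.
move=> a b n pa pb; apply/ffunP => i; apply: contrapT => /eqP ab.
pose v (a : {dffun forall i, T i}) :=
  theta i - int_form (L i) (np a).1 + ((np a).2 i)%:~R.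
have vP a' k : `|map_mx intr k : 'rV[R]_d| <= r -> same_pattern L theta r (np a').1 n ->
    Num.floor (theta i - int_form (L i) (n + k)) -
    Num.floor (theta i - int_form (L i) n) = Num.floor (v a' - int_form (L i) k).
  move=> kr -> //.
  have fl0 : Num.floor (theta i - int_form (L i) (np a').1) = - (np a').2 i.
    have /andP[h1 h2] := npP a' i; have /andP[h3 h4] := xP i (a' i).
    have [_ h5 _] := etaD i (a' i) (a' i).
    by apply: floor_def; rewrite intrD intrN; apply/andP; split; lra.
  rewrite fl0 opprK /v -[_ + _ - int_form _ _]addrAC.
  rewrite (floorDrz _ (intr_int _ ((np a').2 i))) intrKfloor.
  by rewrite int_formD opprD addrA.
(* A pattern tells on which side of each cut the point lies: if n carries both patterns, the point
   of a' is not below the cut of b'. Used both ways, this puts the two cuts less than eta apart. *)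
have key (a' b' : {dffun forall i, T i}) : same_pattern L theta r (np a').1 n ->
    same_pattern L theta r (np b').1 n -> x i (b' i) <= v a'.
  move=> pa' pb'; have := fr i (b' i) => kr.
  have := vP a' _ kr pa'; rewrite (vP b' _ kr pb') => fe.
  have /andP[h1 h2] := npP b' i.
  have : - Num.floor (int_form (L i) (f i (b' i))) <=
      Num.floor (v b' - int_form (L i) (f i (b' i))).
    by rewrite floor_ge_int intrN /v; move: h1; rewrite {1}/x; lra.
  by rewrite fe floor_ge_int intrN /x; lra.
have := key a b pa pb; have := key b a pb pa.
have /andP[_ va] := npP a i; have /andP[_ vb] := npP b i.
have [_ _ /(_ ab)] := etaD i (a i) (b i); rewrite /v ler_normr => /orP[h|h] h1 h2; lra.
Qed.

End Counting.

(** * Necessity of the two conditions, and the criterion over Z^d *)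

Section Necessity.
Variables (R : realType) (d c : nat) (L : 'I_c -> {scalar 'rV[R]_d}).
Variable theta : 'I_c -> R.

(** Combinations of the rows of [P i] with coefficients up to r / K give about r^(m_i) values of L_i
    that are distinct modulo 1, and density realises every choice of one value per coordinate. An
    exponent m_i may be 0: the only value is then 0, and the i-th coordinate is confined to [0,
    delta). *)
Lemma many_patterns (m : 'I_c -> nat) (P : forall i, 'M[int]_(m i, d)) :
  dense_mod1 L ->
  (forall i v, v *m P i \in ker_mod1 (L i) -> v = 0) ->
  exists2 K : R, 0 < K & forall r delta, 1 <= r -> 0 < delta ->
  exists (A : finType) (pt : A -> 'rV[int]_d) (pp : A -> 'I_c -> int),
    [/\ K * r ^+ (\sum_i m i) <= #|A|%:R,
      forall a b n, same_pattern L theta r (pt a) n ->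
        same_pattern L theta r (pt b) n -> a = b &
      forall a i, m i = 0%N ->
        0 <= theta i - int_form (L i) (pt a) + (pp a i)%:~R < delta].
Proof.
move=> dens PS.
have /all_sig2[k k0 kP] := fun i => cid2 (mulmx_norm_bound (map_mx intr (P i) : 'M[R]_(_, _))).
pose K := 1 + \sum_i k i.
have K1 : 1 <= K by rewrite lerDl sumr_ge0 // => i _; apply: ltW.
have K0 : 0 < K by apply: lt_le_trans K1.
have kK i : k i <= K.
  rewrite /K (bigD1 i) //= addrCA lerDl addr_ge0 // sumr_ge0 // => j _.
  exact: ltW.
exists (K^-1 ^+ (\sum_i m i)) => [|r delta r1 delta0].
  by rewrite exprn_gt0 // invr_gt0.
have r0 : 0 < r by apply: lt_le_trans r1.
set W := (Num.truncn (r / K)).+1.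
pose T i : finType := {ffun 'I_(m i) -> 'I_W}.
pose vec i (a : T i) : 'rV[int]_(m i) := \row_j (a j : nat)%:Z.
pose f i (a : T i) := vec i a *m P i.
have fr i a : `|map_mx intr (f i a) : 'rV[R]_d| <= r.
  rewrite map_mxM (le_trans (kP i _)) // (@le_trans _ _ (k i * (r / K))) //.
    rewrite ler_pM2l //; apply/rV_norm_leP => [|j]; first by rewrite divr_ge0 ?ltW.
    rewrite !mxE ger0_norm //.
    by rewrite /= -pmulrn -truncn_ge_nat ?divr_ge0 ?(ltW r0) ?(ltW K0) // -ltnS.
  by rewrite mulrCA ger_pMr // ler_pdivrMr // mul1r.
have finj i (a b : T i) : f i a - f i b \in ker_mod1 (L i) -> a = b.
  rewrite -mulmxBl => /PS /eqP; rewrite subr_eq0 => /eqP /rowP ab.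
  by apply/ffunP => j; apply: val_inj; have := ab j; rewrite !mxE => -[].
have [pt [pp [ptinj ptP]]] := separated_patterns theta dens delta0 fr finj.
exists {dffun forall i, T i}, pt, pp; split=> //.
  rewrite card_dep_ffun foldrE big_image /=.
  have cT i : #|T i| = (W ^ m i)%N by rewrite card_ffun !card_ord.
  rewrite [X in _ <= X%:R](_ : _ = W ^ (\sum_i m i))%N; last first.
    by rewrite expn_sum; apply: eq_bigr => i _; apply: cT.
  rewrite natrX -exprMn lerXn2r ?nnegrE ?mulr_ge0 ?invr_ge0 ?(ltW K0) ?(ltW r0) //.
  by rewrite mulrC ltW // truncnS_gt.
move=> a i mi; have := ptP a i; rewrite /= (_ : f i (a i) = 0).
  by rewrite raddf0 floor0 !subr0.
rewrite /f; move: (vec i (a i)) (P i); rewrite mi => v Q.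
by rewrite (_ : v = 0) ?mul0mx //; apply/rowP => -[].
Qed.

(** [pattern_shift_count] applies with w just above C r, and 2 w + 3 <= (2 C + 5) r because r >=
    1. *)
Lemma pattern_count_bound : lattice_repetitive L theta ->
  exists2 C : R, 0 < C & forall r (A B : finType) (pt : A -> 'rV[int]_d)
    (q : B -> 'rV[int]_d), 1 <= r ->
    (forall a b n, same_pattern L theta r (pt a) n ->
      same_pattern L theta r (pt b) n -> a = b) ->
    (forall a b i j n n', same_pattern L theta r (pt a) n ->
      same_pattern L theta r (pt b) n' -> n - q i = n' - q j -> i = j) ->
    #|B|%:R * #|A|%:R <= C * r ^+ d.
Proof.
move=> [C C0 CP]; exists ((2 * C + 5) ^+ d).
  by rewrite exprn_gt0 // addr_gt0 // mulr_gt0.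
move=> r A B pt q r1 ptinj qinj; pose w := (Num.truncn (C * r)).+1.
have Cr0 : 0 <= C * r by rewrite mulr_ge0 ?(ltW C0) // (le_trans ler01).
have := @pattern_shift_count _ _ _ L theta r w A B pt q _ ptinj qinj.
have rep n n0 : exists2 n', `|map_mx intr n' - map_mx intr n0 : 'rV[R]_d| <= w%:R &
    same_pattern L theta r n n'.
  have [n' n'n0 pn'] := CP r n n0 r1; exists n' => //.
  by apply: le_trans n'n0 _; apply/ltW/truncnS_gt.
move=> /(_ rep); rewrite -(ler_nat R) natrM => /le_trans; apply.
have X0 : 0 <= (2 * C + 5) * r by nra.
rewrite natrX -exprMn lerXn2r ?nnegrE ?X0 //.
have : (Num.truncn (C * r))%:R <= C * r by rewrite truncn_le.
by rewrite /w natrD natrM -natr1; nra.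
Qed.

Lemma exp_bound_leq (K C : R) (a b : nat) : 0 < K -> 0 < C ->
  (forall r, 1 <= r -> K * r ^+ a <= C * r ^+ b) -> (a <= b)%N.
Proof.
move=> K0 C0 h; rewrite leqNgt; apply/negP => ba.
have r1 : 1 <= 1 + C / K by rewrite lerDl divr_ge0 ?ltW.
have r0 : 0 < 1 + C / K by apply: lt_le_trans r1.
have := h _ r1; rewrite -(subnKC ba) exprD exprSr -mulrA mulrCA [leRHS]mulrC.
rewrite ler_pM2l ?exprn_gt0 // leNgt => /negP; apply.
apply: (@lt_le_trans _ _ (K * (1 + C / K))).
  by rewrite mulrDr mulr1 mulrCA divff ?gt_eqF // mulr1 ltrDr.
by rewrite ler_pM2l // ler_peMr ?(ltW r0) // exprn_ege1.
Qed.

Lemma rk_sum_le : lattice_repetitive L theta -> dense_mod1 L ->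
  (\sum_i (d - rk (ker_mod1 (L i))) <= d)%N.
Proof.
move=> rep dens.
have /(_ _)/cid -/all_sig[P PP] := fun i => ker_mod1_complement (L i).
have [K K0 KP] := many_patterns dens (fun i => (PP i).1).
have [C C0 CP] := pattern_count_bound rep.
apply: (exp_bound_leq K0 C0) => r r1.
have [A [pt [_ [cA ptinj _]]]] := KP r 1 r1 ltr01.
apply: le_trans cA _.
have := CP r A unit pt (fun=> 0) r1 ptinj; rewrite card_unit mul1r; apply.
by move=> a b [] [].
Qed.

(** If the kernel had full rank, some nonzero N would map Z^d into it, so L_i would take its values
    in (1 / N) Z, which stays at distance 1 / (2 |N|) from 1 / (2 N). *)
Lemma rk_ker_lt (i : 'I_c) : dense_mod1 L -> (rk (ker_mod1 (L i)) < d)%N.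
Proof.
move=> dens; rewrite ltnNge; apply/negP => dr.
have [M MS Mf] := rk_basis (ker_mod1 (L i)).
have [N N0 [Q QE]] := int_free_decomp dr Mf.
have NZ : 0 < `|N%:~R : R| by rewrite normr_gt0 intr_eq0.
have [|n [p np]] := dens (fun=> (2 * N%:~R)^-1) (4 * `|N%:~R|)^-1.
  by rewrite invr_gt0 mulr_gt0.
have : N *: n \in ker_mod1 (L i).
  by rewrite QE; apply: zmod_closed_comb => //; apply: ker_mod1_zmod_closed.
rewrite ker_mod1E int_formZ => /intrP[z zE].
have := np i; rewrite -(ltr_pM2l NZ) -normrM !mulrBr mulrDr zE -intrM -intrD.
rewrite !invfM [X in _ - X]mulrCA mulfV ?intr_eq0 // mulr1 mulrCA mulfV ?gt_eqF //.
rewrite mulr1 => h.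
have : `|(2 * (z + N * p i) - 1)%:~R : R| < 1.
  rewrite intrB intrM (_ : _ - _ = 2 * ((z + N * p i)%:~R - 2^-1)); last by field.
  by rewrite normrM ger0_norm //; lra.
rewrite -intr_norm ltrz1 -abszE; move: (z + _) => y; rewrite ltz_nat; lia.
Qed.

(** Since theta_i - L_i(n) lies in [0, delta) modulo 1, subtracting z + delta from it crosses an
    integer. Equality of the floor differences makes the same crossing happen at n'. *)
Lemma same_pattern_near0 (i : 'I_c) (r delta : R) (k n n' : 'rV[int]_d) (z p : int) :
  `|map_mx intr k : 'rV[R]_d| <= r -> int_form (L i) k = z%:~R + delta ->
  delta <= 1 -> 0 <= theta i - int_form (L i) n + p%:~R < delta ->
  same_pattern L theta r n n' ->
  exists u : int, 0 <= theta i - int_form (L i) n' - u%:~R < delta.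
Proof.
move=> kr kz delta1 /andP[v1 v2] /(_ k i kr).
have -> : Num.floor (theta i - int_form (L i) n) = - p.
  by apply: floor_def; rewrite intrD intrN; apply/andP; split; lra.
have -> : Num.floor (theta i - int_form (L i) (n + k)) = - p - z - 1.
  apply: floor_def; rewrite int_formD kz.
  by rewrite subrK intrB (intrB _ _ z) intrN; apply/andP; split; lra.
set u := Num.floor (theta i - int_form (L i) n').
move=> E; exists u.
have /andP[u1 _] := floor_itv (theta i - int_form (L i) n').
have /andP[_] := floor_itv (theta i - int_form (L i) (n' + k)).
rewrite -(subrK u (Num.floor _)) E (_ : _ - - p + u = u - z - 1); last by ring.
rewrite subrK int_formD kz intrB => u2.
by rewrite -/u in u1; apply/andP; split; lra.
Qed.

(** Modulo 1, a + s lies in (x, x + 2 delta) and b + t in (y, y + 2 delta). Both intervals fit in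
    [0, 1], so there is no wrap-around and they must meet. *)
Lemma translate_lt (delta a b x y s t : R) (u v p q : int) :
  0 <= a - u%:~R < delta -> 0 <= b - v%:~R < delta ->
  `|s + p%:~R - (x + delta / 2)| < delta / 2 ->
  `|t + q%:~R - (y + delta / 2)| < delta / 2 ->
  a + s = b + t -> 0 <= x -> 0 <= y ->
  x + 2 * delta <= 1 -> y + 2 * delta <= 1 -> x < y + 2 * delta.
Proof.
rewrite !ltr_norml => /andP[l1 h1] /andP[l2 h2] /andP[l3 h3] /andP[l4 h4] e.
move=> x0 y0 x1 y1.
have uE : u + q = v + p.
  apply/eqP; rewrite -subr_eq0 -absz_eq0 -leqn0 -ltnS -ltz_nat abszE -(ltr_int R).
  rewrite intr_norm.
  by rewrite ltr_norml intrB 2!intrD; apply/andP; split; lra.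
have : u%:~R + q%:~R = v%:~R + p%:~R :> R by rewrite -!intrD uE.
by move=> e'; lra.
Qed.

(* A value [delta] of [L_i] close to 0 cuts [0, 1) at [delta], so that all the
   occurrences of the patterns above [0, delta) lie there.  Shifting them by
   vectors which translate [0, delta) to about 1 / (2 delta) disjoint intervals
   shows that they are rare. *)
Lemma lattice_repetitive_lower_bound (i0 : 'I_c) :
  lattice_repetitive L theta -> dense_mod1 L ->
  (\sum_i (d - rk (ker_mod1 (L i))) = d)%N ->
  exists2 C : R, 0 < C & forall n, n \notin ker_mod1 (L i0) ->
    C / `|map_mx intr n : 'rV[R]_d| ^+ (d - rk (ker_mod1 (L i0))) <=
    dist_int (int_form (L i0) n).
Proof.
move=> rep dens sm.
(* With the exponent at i0 set to 0, the patterns vary only in the other coordinates, while their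
   i0-th coordinate is confined to [0, delta). *)
pose m i := if i == i0 then 0%N else (d - rk (ker_mod1 (L i)))%N.
have /(_ _)/cid -/all_sig[P PP] i : exists P : 'M[int]_(m i, d),
    forall v, v *m P \in ker_mod1 (L i) -> v = 0.
  rewrite /m; case: eqP => _; first by exists 0 => v _; apply/rowP => -[].
  by have [P [PS _]] := ker_mod1_complement (L i); exists P.
have [K K0 KP] := many_patterns dens PP.
have [C C0 CP] := pattern_count_bound rep.
exists (K / (4 * C)) => [|n nS]; first by rewrite divr_gt0 // mulr_gt0.
set r := `|map_mx intr n : 'rV[R]_d|.
have r1 : 1 <= r.
  apply: intV_norm_ge1; apply: contra nS => /eqP ->.
  by have [] := ker_mod1_zmod_closed (L i0).
have r0 : 0 < r by apply: lt_le_trans r1.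
(* One of n and -n takes a value at most 1/2 above an integer, at a distance not exceeding
   [dist_int]. *)
have [k [z [delta [kr kz /andP[delta0 delta1] deltaD]]]] :
    exists (k : 'rV[int]_d) (z : int) (delta : R),
    [/\ `|map_mx intr k : 'rV[R]_d| <= r, int_form (L i0) k = z%:~R + delta,
      0 < delta <= 2^-1 & delta <= dist_int (int_form (L i0) n)].
  have := dist_int_ge_frac (int_form (L i0) n); set x := int_form (L i0) n.
  set f := Num.floor x => /= fle.
  have /andP[f1 f2] := floor_itv x; rewrite intrD -/f in f1 f2.
  have {}f1 : f%:~R < x.
    by rewrite lt_neqAle f1 andbT; apply: contra nS => /eqP E;
      rewrite ker_mod1E -/x -E intr_int.
  have [h|h] := leP (x - f%:~R) 2^-1.
    exists n, f, (x - f%:~R); split=> //; first by rewrite -/x; ring.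
      by rewrite subr_gt0 f1.
    by apply: le_trans fle; rewrite le_min lexx /=; lra.
  exists (- n), (- (f + 1)), (f%:~R + 1 - x); split.
  - by rewrite map_mxN normrN.
  - by rewrite raddfN -/x intrN intrD; ring.
  - by apply/andP; split; lra.
  - by apply: le_trans fle; rewrite le_min lexx andbT; lra.
apply: le_trans deltaD.
have [A [pt [pp [cA ptinj ptP]]]] := KP r delta r1 delta0.
move: cA.
have inI a n' : same_pattern L theta r (pt a) n' ->
    exists u : int, 0 <= theta i0 - int_form (L i0) n' - u%:~R < delta.
  apply: (same_pattern_near0 (p := pp a i0) kr kz); last first.
    by apply: ptP; rewrite /m eqxx.
  by apply: le_trans delta1 _; rewrite invf_le1 ?ler1n.
(* M intervals of length 2 delta fit in [0, 1]; the j-th shift moves [0, delta), modulo 1, into (2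
   delta j, 2 delta (j + 1)). *)
pose M := Num.truncn (2 * delta)^-1.
have d2 : 0 < 2 * delta by rewrite mulr_gt0.
have M1 : M%:R <= (2 * delta)^-1 by rewrite truncn_le invr_ge0 ltW.
have M2 : (4 * delta)^-1 <= M%:R.
  have h1 : 1 <= M%:R :> R.
    by rewrite ler1n truncn_gt0 invf_ge1 //; lra.
  have h2 : (2 * delta)^-1 < M%:R + 1 by rewrite natr1 truncnS_gt.
  rewrite (_ : (4 * delta)^-1 = (2 * delta)^-1 / 2); last first.
    by rewrite -invfM mulrAC -natrM.
  lra.
have /(_ _)/cid -/all_sig[q qP] (j : 'I_M) : exists q, exists p : int,
    `|int_form (L i0) q + p%:~R - (2 * delta * j%:R + delta / 2)| < delta / 2.
  have [|q [p qp]] := dens (fun=> 2 * delta * j%:R + delta / 2) (delta / 2).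
    by rewrite divr_gt0.
  by exists q, (p i0).
have jM (j : 'I_M) : 2 * delta * j%:R + 2 * delta <= 1.
  have : j.+1%:R <= M%:R :> R by rewrite ler_nat.
  rewrite -natr1 => h; rewrite -[X in _ + X]mulr1 -mulrDr.
  by rewrite -ler_pdivlMl // mulr1 (le_trans h).
have cnt := CP r A 'I_M pt q r1 ptinj; rewrite card_ord in cnt.
have {}cnt : M%:R * #|A|%:R <= C * r ^+ d.
  apply: cnt => a b i j n1 n2 /inI[u1 h1] /inI[u2 h2] E.
  have [p1 h3] := qP i; have [p2 h4] := qP j.
  have := congr1 (int_form (L i0)) E; rewrite !raddfB => {}E.
  have dj (x : 'I_M) : 0 <= 2 * delta * x%:R by rewrite mulr_ge0 // ltW.
  have lt1 (x y : 'I_M) : 2 * delta * x%:R < 2 * delta * y%:R + 2 * delta ->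
      (x <= y)%N.
    by rewrite -[X in _ + X]mulr1 -mulrDr ltr_pM2l // natr1 ltr_nat ltnS.
  have e1 : theta i0 - int_form (L i0) n1 + int_form (L i0) (q i) =
      theta i0 - int_form (L i0) n2 + int_form (L i0) (q j) by lra.
  apply/val_inj/eqP; rewrite eqn_leq; apply/andP; split; apply: lt1.
    by apply: (translate_lt h1 h2 h3 h4 e1); rewrite ?dj ?jM.
  by apply: (translate_lt h2 h1 h4 h3 (esym e1)); rewrite ?dj ?jM.
have sm' : (\sum_i m i + (d - rk (ker_mod1 (L i0))) = d)%N.
  rewrite -[RHS]sm (bigD1 i0) //= {1}/m eqxx add0n [RHS](bigD1 i0) //= addnC.
  by congr (_ + _)%N; apply: eq_bigr => i /negPf ne; rewrite /m ne.
(* At least 1 / (4 delta) shifts are available. Cancelling the power of r contributed by the other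
   coordinates leaves K / (4 C) <= delta r^(d - rk), with rk the rank of the kernel at i0. *)
move=> cA; have : (4 * delta)^-1 * (K * r ^+ (\sum_i m i)) <= C * r ^+ d.
  apply: le_trans cnt; apply: ler_pM => //; first by rewrite invr_ge0 mulr_ge0 // ltW.
  by rewrite mulr_ge0 ?exprn_ge0 // ltW.
rewrite -[in leRHS]sm' exprD ler_pdivrMl ?mulr_gt0 //.
have ra : 0 < r ^+ (\sum_i m i) by rewrite exprn_gt0.
have rb : 0 < r ^+ (d - rk (ker_mod1 (L i0))) by rewrite exprn_gt0.
rewrite mulrC (_ : _ * (C * _) = r ^+ (\sum_i m i) *
  (delta * r ^+ (d - rk (ker_mod1 (L i0))) * (4 * C))); last first.
  by move: (r ^+ _) (r ^+ _) => x y; ring.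
by rewrite ler_pM2l // => h; rewrite !ler_pdivrMr ?mulr_gt0.
Qed.

Theorem lattice_repetitiveP : (0 < d)%N -> (0 < c)%N -> dense_mod1 L ->
  (forall n, (forall i, n \in ker_mod1 (L i)) -> n = 0) ->
  lattice_repetitive L theta <->
  (\sum_i rk (ker_mod1 (L i)))%N = (d * (c - 1))%N /\
  forall i, relatively_badly_approximable (L i).
Proof.
move=> d0 c0 dens ker0.
(* Through this identity (LR1) becomes the equality of the sum of the codimensions with d. *)
have sumE : (\sum_i (d - rk (ker_mod1 (L i))) + \sum_i rk (ker_mod1 (L i)) = d * c)%N.
  rewrite -big_split /= (eq_bigr (fun=> d)) => [|i _]; last by rewrite subnK ?rk_leq.
  by rewrite sum_nat_const card_ord mulnC.
have dcE : (d * c = d * (c - 1) + d)%N by rewrite mulnBr muln1 subnK // leq_pmulr.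
split=> [rep|[sm rba]].
  have sm : (\sum_i (d - rk (ker_mod1 (L i))) = d)%N.
    apply/eqP; rewrite eqn_leq rk_sum_le // rk_sum_ge // => i.
    exact: ker_mod1_zmod_closed.
  split=> [|i]; first by move: sumE; rewrite sm dcE; lia.
  apply/relatively_badly_approximableP; split; first by rewrite subn_gt0 rk_ker_lt.
  exact: lattice_repetitive_lower_bound.
have ba i := (relatively_badly_approximableP (L i)).1 (rba i).
apply: (@lattice_repetitive_bad_approx _ _ _ L (fun i => d - rk (ker_mod1 (L i)))%N) => //.
- by move=> i; have [] := ba i.
- by move: sumE; rewrite sm dcE; lia.
- by move=> i; have [] := ba i.
Qed.

End Necessity.

(** * From cut and project sets to patterns over Z^d *)

Lemma linear_rV_bound (R : realType) (m n : nat) (f : {linear 'rV[R]_m -> 'rV[R]_n}) :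
  exists2 K : R, 0 < K & forall v, `|f v| <= K * `|v|.
Proof.
have [K K0 KP] := mulmx_norm_bound (lin1_mx f).
by exists K => // v; rewrite -mul_rV_lin1.
Qed.

Lemma daddv_pi0 (K : fieldType) (V : vectType K) (A B : {vspace V}) (w : V) :
  complementary A B -> w \in B -> daddv_pi A B w = 0.
Proof.
move=> [AB AB0] wB; have := @daddv_pi_add _ _ _ _ w AB0.
rewrite AB memvf => /(_ isT); rewrite [X in _ + X]daddv_pi_id //; last by rewrite capvC.
by move=> /eqP; rewrite -subr_eq0 addrK => /eqP.
Qed.

Section Geometry.
Variables (R : realType) (d c : nat) (L : 'I_c -> {scalar 'rV[R]_d}).

Lemma graph_map_is_linear : linear (graph_map L).
Proof.
move=> a x y; rewrite /graph_map scale_row_mx add_row_mx; congr row_mx.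
by apply/rowP => i; rewrite !mxE linearP.
Qed.

HB.instance Definition _ := GRing.isLinear.Build R 'rV[R]_d 'rV[R]_(d + c) *:%R
  (graph_map L) graph_map_is_linear.

Lemma graph_map_physical x : graph_map L x \in physical L.
Proof. by apply/memv_physical; exists x. Qed.

Lemma graph_map_norm_ge x : `|x| <= `|graph_map L x|.
Proof.
apply/rV_norm_leP => // j; apply: le_trans (rV_coord_le _ (lshift c j)).
by rewrite row_mxEl.
Qed.

Lemma torus_pi_eq (n : nat) (x y : 'rV[R]_n) :
  torus_pi x = torus_pi y <-> exists z, x - y = map_mx intr z.
Proof.
split=> [xy|[z xyz]].
  have : lattice_coset (torus_pi y) x by [].
  by rewrite lattice_cosetE => -[_ [z _ <-] <-]; exists z; rewrite addrK.
have : lattice_coset (torus_pi y) x; last by [].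
by rewrite lattice_cosetE; exists (x - y); rewrite ?subrK //; exists z.
Qed.

(** Density provides a point (x, L(x)) of E close to (0, t) modulo Z^k. Then x is close to an
    integer vector, and replacing x by that vector changes each L_i(x) only a little. *)
Lemma totally_irrational_dense_mod1 : totally_irrational L -> dense_mod1 L.
Proof.
move=> irr t e e0; have [K K0 KP] := linear_rV_bound (graph_map L).
pose delta := e / (K + 1).
have K1 : 0 < K + 1 by rewrite addr_gt0.
have delta0 : 0 < delta by rewrite divr_gt0.
pose y0 : 'rV[R]_(d + c) := row_mx 0 (\row_i t i).
pose O : set (torus R (d + c)) := [set torus_pi y | y in [set y | `|y - y0| < delta]].
have Oopen : open O.
  rewrite -[open O]/(open (@torus_pi R (d + c) @^-1` O)) openE => y' [y /= yy0 yy'].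
  apply/nbhs_ballP; exists (delta - `|y - y0|) => /=; first by rewrite subr_gt0.
  move=> y''; rewrite -ball_normE /= => h.
  exists (y + (y'' - y')) => /=.
    rewrite addrAC (le_lt_trans (ler_normD _ _)) // -ltrBrDl.
    by rewrite distrC in h.
  have [z zE] := (torus_pi_eq _ _).1 yy'.
  by apply/torus_pi_eq; exists z; rewrite -zE (addrC y'') addrA addrK.
have [|_ [[y /= yy0 <-] [v /memv_physical[x ->] vy]]] := irr O _ Oopen.
  by exists (torus_pi y0), y0 => //=; rewrite subrr normr0.
have [u uE] := (torus_pi_eq _ _).1 (esym vy).
have yE : y = graph_map L x + map_mx intr u by rewrite -uE addrC subrK.
have xu : `|map_mx intr (- lsubmx u) - x| <= `|y - y0|.
  apply/rV_norm_leP => // j; apply: le_trans (rV_coord_le _ (lshift c j)).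
  rewrite yE /y0 !mxE -/(lshift c j) (unsplitK (inl j)) mxE subr0 -normrN.
  by rewrite intrN opprB opprK addrC.
exists (- lsubmx u), (fun i => rsubmx u 0 i) => i.
have h1 : `|L i x + (rsubmx u 0 i)%:~R - t i| <= `|y - y0|.
  apply: le_trans (rV_coord_le _ (rshift d i)).
  by rewrite yE /y0 !mxE (unsplitK (inr i)) !mxE.
have h2 : `|L i (map_mx intr (- lsubmx u) - x)| <= K * `|y - y0|.
  apply: (@le_trans _ _ `|graph_map L (map_mx intr (- lsubmx u) - x)|).
    apply: le_trans (rV_coord_le _ (rshift d i)).
    by rewrite /graph_map row_mxEr mxE.
  by apply: le_trans (KP _) _; rewrite ler_pM2l.
rewrite (_ : _ - t i = L i (map_mx intr (- lsubmx u) - x) +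
  (L i x + (rsubmx u 0 i)%:~R - t i)); last by rewrite linearB /int_form /=; ring.
apply: le_lt_trans (ler_normD _ _) _; apply: le_lt_trans (lerD h2 h1) _.
rewrite -[X in _ + X]mul1r -mulrDl mulrC -ltr_pdivlMr //.
Qed.

End Geometry.

Section Parametrization.
Variables (R : realType) (d c : nat) (L : 'I_c -> {scalar 'rV[R]_d}).
Variables (F : {vspace 'rV[R]_(d + c)}) (x0 : 'rV[R]_(d + c)).
Hypothesis admF : admissible_internal L F.

Let W := cubical_window R d c.
Let s := torus_pi x0.

(** The height of [x0] over the physical space in the direction {0} x R^c; it takes the place of
    theta. *)
Definition offset (i : 'I_c) : R := rsubmx x0 0 i - L i (lsubmx x0).

(* Above each [n] in Z^d there is exactly one point of the strip. *)
Definition strip_int (n : 'rV[int]_d) : 'rV[int]_(d + c) :=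
  row_mx n (\row_i - Num.floor (offset i - int_form (L i) n)).

Definition strip_lift (n : 'rV[int]_d) : 'rV[R]_(d + c) :=
  map_mx intr (strip_int n) + x0.

Definition strip_frac (n : 'rV[int]_d) : 'rV[R]_c :=
  \row_i (offset i - int_form (L i) n -
    (Num.floor (offset i - int_form (L i) n))%:~R).

Definition cp_point (n : 'rV[int]_d) : 'rV[R]_(d + c) :=
  proj_pi L F (strip_lift n).

Lemma strip_frac_itv n i : 0 <= strip_frac n 0 i < 1.
Proof.
rewrite mxE; have /andP[h1 h2] := floor_itv (offset i - int_form (L i) n).
by rewrite intrD in h2; apply/andP; split; lra.
Qed.

Lemma strip_liftE n : strip_lift n =
  graph_map L (map_mx intr n + lsubmx x0) + row_mx 0 (strip_frac n).
Proof.
rewrite /strip_lift /strip_int map_row_mx -[X in _ + X]hsubmxK !add_row_mx addr0.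
congr row_mx; apply/rowP => i; rewrite !mxE linearD /offset /int_form /= mxE intrN.
by ring.
Qed.

Lemma strip_pointsP p : strip_points L W s p <-> exists n, p = strip_lift n.
Proof.
split=> [[[_ [t [t01 ->]] [_ /memv_physical[x ->] <-]]]|[n ->]].
  rewrite /s lattice_cosetE => -[_ [u _ <-] uE].
  exists (lsubmx u); rewrite -uE /strip_lift; congr (map_mx _ _ + _).
  rewrite -[LHS]hsubmxK /strip_int; congr row_mx; apply/rowP => i.
  have xE : x = map_mx intr (lsubmx u) + lsubmx x0.
    by have := congr1 lsubmx uE; rewrite linearD /= add_row_mx add0r row_mxKl -map_lsubmx.
  have := congr1 (fun v : 'rV_(d + c) => rsubmx v 0 i) uE.
  rewrite linearD /= add_row_mx row_mxKr !mxE xE linearD /= => tE.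
  suff fE : Num.floor (offset i - int_form (L i) (lsubmx u)) = - u 0 (rshift d i).
    by rewrite fE opprK.
  apply: floor_def; rewrite intrD intrN /offset /int_form !mxE.
  have /andP[t0 t1] := t01 i; apply/andP; split; lra.
split; last first.
  by rewrite /s lattice_cosetE; exists (map_mx intr (strip_int n)) => //; exists (strip_int n).
rewrite strip_liftE; exists (row_mx 0 (strip_frac n)).
  by exists (strip_frac n); split=> // i; apply: strip_frac_itv.
exists (graph_map L (map_mx intr n + lsubmx x0)); last by rewrite addrC.
exact: graph_map_physical.
Qed.

Lemma proj_pi_int_inj (u v : 'rV[int]_(d + c)) :
  proj_pi L F (map_mx intr u) = proj_pi L F (map_mx intr v) -> u = v.
Proof.
move=> uv; apply: (@map_intmx_inj R); case: admF => _; apply=> //; apply/mem_set;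
  by [exists u | exists v].
Qed.

Lemma cp_point_inj : injective cp_point.
Proof.
move=> n n'; rewrite /cp_point /strip_lift !linearD => /addIr /proj_pi_int_inj.
by move=> /(congr1 lsubmx); rewrite !row_mxKl.
Qed.

Lemma cp_pointB n k : cp_point (n + k) - cp_point n =
  proj_pi L F (map_mx intr (strip_int (n + k) - strip_int n)).
Proof.
by rewrite -linearB /strip_lift map_mxB opprD addrACA subrr addr0.
Qed.

Lemma cut_projectP y : cut_project L F W s y <-> exists n, y = cp_point n.
Proof.
split=> [[p /strip_pointsP[n ->] <-]|[n ->]]; first by exists n.
by exists (strip_lift n) => //; apply/strip_pointsP; exists n.
Qed.

Lemma lift_cp_point n : lift_point L F W s (cp_point n) = strip_lift n.
Proof.
rewrite /lift_point; set P := [set _ | _].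
have : P (get P).
  apply: getPex; exists (strip_lift n); split=> //.
  by apply/strip_pointsP; exists n.
by move=> [/strip_pointsP[n' ->] /cp_point_inj ->].
Qed.

Lemma proj_rho_strip_lift n k :
  proj_rho L (strip_lift (n + k) - strip_lift n) = graph_map L (map_mx intr k).
Proof.
rewrite !strip_liftE opprD addrACA -linearB /= map_mxD.
rewrite opprD addrACA subrr addr0 [map_mx intr n + _]addrC addrK linearD /=.
rewrite [X in X + _]daddv_pi_id ?graph_map_physical //; last by case: (physical_F_rho L).
rewrite [X in _ + X]daddv_pi0 ?addr0 //; first exact: physical_F_rho.
by apply: memvB; apply/memv_F_rho; eexists.
Qed.

Lemma patchP Omega n r y : Defs.patch L F W s Omega (cp_point n) r y <->
  exists2 k, [set r *: w | w in Omega] (graph_map L (map_mx intr k)) &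
    y = cp_point (n + k).
Proof.
split=> [[/cut_projectP[n' ->]]|[k kO ->]].
  rewrite !lift_cp_point -[n'](addrNK n) (addrC _ n) proj_rho_strip_lift => h.
  by exists (n' - n).
split; first by apply/cut_projectP; exists (n + k).
by rewrite !lift_cp_point proj_rho_strip_lift.
Qed.

(** As pi is injective on Z^k, the displacement between two points of Y determines the integer
    vector between their lifts, that is, k together with all the floor differences. *)
Lemma patch_equivP Omega r n n' :
  patch_equiv L F W s Omega r (cp_point n') (cp_point n) <->
  forall k i, [set r *: w | w in Omega] (graph_map L (map_mx intr k)) ->
    Num.floor (offset i - int_form (L i) (n' + k)) -
    Num.floor (offset i - int_form (L i) n') =
    Num.floor (offset i - int_form (L i) (n + k)) -
    Num.floor (offset i - int_form (L i) n).
Proof.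
split=> [E k i kO|E].
  have : Defs.patch L F W s Omega (cp_point n') r (cp_point (n' + k)).
    by apply/patchP; exists k.
  rewrite E => -[_ /patchP[k' _ ->]] /eqP.
  rewrite addrAC eq_sym -subr_eq eq_sym cp_pointB cp_pointB => /eqP /proj_pi_int_inj e.
  have kk : k' = k.
    have := congr1 lsubmx e; rewrite !linearB /= !row_mxKl.
    by rewrite !(addrC _ k) !(addrC _ k') !addrK.
  have := congr1 (fun v : 'rV_(d + c) => rsubmx v 0 i) e.
  rewrite kk !linearB /= !row_mxKr !mxE !opprK => e'.
  by apply: oppr_inj; rewrite !opprB addrC -e' addrC.
have key k : [set r *: w | w in Omega] (graph_map L (map_mx intr k)) ->
    cp_point (n' + k) - cp_point n' = cp_point (n + k) - cp_point n.
  move=> kO; rewrite !cp_pointB; congr (proj_pi L F (map_mx intr _)).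
  rewrite /strip_int !opp_row_mx !add_row_mx; congr row_mx.
    by rewrite !(addrC _ k) !addrK.
  by apply/rowP => i; rewrite !mxE -!opprD (E k i kO).
apply/seteqP; split=> y.
  move=> /patchP[k kO ->]; exists (cp_point (n + k)).
    by apply/patchP; exists k.
  by rewrite addrAC -(key k kO) subrK.
move=> [_ /patchP[k kO ->] <-]; apply/patchP; exists k => //.
by rewrite addrAC -(key k kO) subrK.
Qed.

Lemma proj_pi_graph_map x : proj_pi L F (graph_map L x) = graph_map L x.
Proof. by case: admF => -[_ FE] _; apply/daddv_pi_id/graph_map_physical. Qed.

(** Since pi fixes E, the two points differ by a fixed vector plus the projection of a point of the
    bounded window. *)
Lemma cp_point_near_graph : exists2 K : R, 0 < K &
  forall n, `|cp_point n - graph_map L (map_mx intr n)| <= K.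
Proof.
have [K K0 KP] := linear_rV_bound (proj_pi L F).
exists (`|graph_map L (lsubmx x0)| + K) => [|n]; first by rewrite ltr_wpDl.
have -> : cp_point n - graph_map L (map_mx intr n) =
    graph_map L (lsubmx x0) + proj_pi L F (row_mx 0 (strip_frac n)).
  rewrite /cp_point strip_liftE linearD /= proj_pi_graph_map linearD /=.
  by rewrite (addrC (graph_map L (map_mx intr n))) addrAC addrK.
apply: le_trans (ler_normD _ _) _; rewrite lerD2l (le_trans (KP _)) //.
rewrite ger_pMr //; apply/rV_norm_leP => // j.
case: (split_ordP j) => i ->; rewrite ?row_mxEl ?row_mxEr ?mxE ?normr0 //.
have := strip_frac_itv n i; rewrite mxE => /andP[h1 h2].
by rewrite ger0_norm // ltW.
Qed.

End Parametrization.

(** [Omega] contains a neighbourhood of 0 in E and is bounded, and the graph map distorts the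
    maximum norm by bounded factors; patches cut out by r Omega and by |k| <= r can therefore be
    compared. *)
Lemma patch_shape_bounds (R : realType) (d c : nat)
    (L : 'I_c -> {scalar 'rV[R]_d}) (Omega : set 'rV[R]_(d + c)) :
  patch_shape L Omega ->
  exists a b : R, [/\ 0 < a, 0 < b & forall r (x : 'rV[R]_d), 0 < r ->
    (`|x| <= a * r -> [set r *: w | w in Omega] (graph_map L x)) /\
    ([set r *: w | w in Omega] (graph_map L x) -> `|x| <= b * r)].
Proof.
move=> [_ bO _]; rewrite near_withinE => /nbhs_ballP[e /= e0 eP].
have [b b0 bP] := pinfty_ex_gt0 bO.
have [K K0 KP] := linear_rV_bound (graph_map L).
exists (e / (2 * K)), b; split=> //; first by rewrite divr_gt0 // mulr_gt0.
move=> r x r0; split=> [xr|[w wO /= wE]]; last first.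
  apply: le_trans (graph_map_norm_ge L x) _.
  by rewrite -wE normrZ gtr0_norm // mulrC ler_pM2r // bP.
exists (r^-1 *: graph_map L x); last by rewrite scalerA divff ?gt_eqF // scale1r.
apply: eP; last by rewrite -linearZ; apply: graph_map_physical.
rewrite -ball_normE /= sub0r normrN normrZ gtr0_norm ?invr_gt0 //.
rewrite ltr_pdivrMl // (le_lt_trans (KP x)) // -ltr_pdivlMl //.
apply: le_lt_trans xr _; rewrite mulrC mulrA -subr_gt0.
rewrite [X in 0 < X](_ : _ = r * (e / (2 * K))); last by field; rewrite gt_eqF.
by rewrite mulr_gt0 // divr_gt0 // mulr_gt0.
Qed.

Lemma linearly_repetitiveP (R : realType) (d c : nat)
    (L : 'I_c -> {scalar 'rV[R]_d}) (F : {vspace 'rV[R]_(d + c)})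
    (x0 : 'rV[R]_(d + c)) (Omega : set 'rV[R]_(d + c)) :
  admissible_internal L F -> patch_shape L Omega ->
  linearly_repetitive L F (cubical_window R d c) (torus_pi x0) Omega <->
  lattice_repetitive L (offset L x0).
Proof.
move=> admF sO; have [a [b [a0 b0 abP]]] := patch_shape_bounds sO.
have [K0 K00 K0P] := cp_point_near_graph x0 admF.
have [K1 K10 K1P] := linear_rV_bound (graph_map L).
split=> [[C C0 CP]|[C C0 CP]].
  (* At size r A the patch defined by [Omega] sees every k with |k| <= r; the maximum with 1 keeps r
     A >= 1. *)
  pose A := Num.max 1 a^-1.
  have A1 : 1 <= A by rewrite le_max lexx.
  have Aa : 1 <= a * A.
    by rewrite -ler_pdivrMl // mulr1 le_max lexx orbT.
  exists (K0 + C * A / 2) => [|r n n0 r1].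
    by rewrite addr_gt0 // divr_gt0 // mulr_gt0 // (lt_le_trans ltr01).
  have r0 : 0 < r by apply: lt_le_trans r1.
  have rA1 : 1 <= r * A by rewrite mulr_ege1.
  have [||y' [xy' /cut_projectP[n' y'E] eqv]] :=
      CP (r * A) (cp_point L F x0 n) rA1 _ (graph_map L (map_mx intr n0)).
  - by apply/cut_projectP; exists n.
  - exact: graph_map_physical.
  move: xy' eqv; rewrite y'E -ball_normE /= => xy' /(patch_equivP _ admF) eq.
  exists n' => [|k i kr]; last first.
    apply: eq; apply: (abP _ _ _).1; first by apply: lt_le_trans rA1.
    by apply: le_trans kr _; rewrite mulrCA ler_peMr // ltW.
  rewrite -map_mxB; apply: le_trans (graph_map_norm_ge L _) _.
  rewrite map_mxB linearB /=.
  apply: le_trans (ler_distD (cp_point L F x0 n') _ _) _.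
  have := K0P n'; rewrite distrC => h.
  rewrite distrC in xy'; apply: le_trans (lerD h (ltW xy')) _; rewrite mulrDl lerD //.
    by rewrite ler_peMr // ltW.
  by rewrite le_eqVlt; apply/orP; left; apply/eqP; field.
pose B := Num.max 1 b.
have B1 : 1 <= B by rewrite le_max lexx.
have bB : b <= B by rewrite le_max lexx orbT.
have B0 : 0 < B by apply: lt_le_trans B1.
(* The factor 2 turns the diameter into a radius, and the summand 1 gives the strict inequality that
   the open ball requires. *)
exists (2 * (K1 + K1 * (C * B) + K0 + 1)) => [|r y r1 /cut_projectP[n ->] x].
  by rewrite mulr_gt0 // !addr_gt0 // !mulr_gt0.
move=> /memv_physical[x1 ->].
have r0 : 0 < r by apply: lt_le_trans r1.
pose n0 : 'rV[int]_d := \row_j Num.floor (x1 0 j).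
have [|n' n'n0 pat] := CP (r * B) n n0; first by rewrite mulr_ege1.
exists (cp_point L F x0 n'); split.
- rewrite -ball_normE /=.
  apply: le_lt_trans (ler_distD (graph_map L (map_mx intr n')) _ _) _.
  rewrite -linearB /=.
  have h1 : `|x1 - map_mx intr n'| <= 1 + C * (r * B).
    apply: le_trans (ler_distD (map_mx intr n0) _ _) _; apply: lerD; last by rewrite distrC.
    apply/rV_norm_leP => // j; rewrite !mxE.
    have /andP[f1 f2] := floor_itv (x1 0 j); rewrite intrD in f2.
    by rewrite ger0_norm; lra.
  have h2 := K0P n'; rewrite distrC in h2.
  apply: le_lt_trans (lerD (K1P _) h2) _.
  have h3 : K1 * `|x1 - map_mx intr n'| <= K1 * (1 + C * (r * B)) by rewrite ler_pM2l.
  apply: le_lt_trans (lerD h3 (lexx _)) _.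
  rewrite (_ : _ / 2 = K1 * r + K1 * (C * (r * B)) + K0 * r + r); last by field.
  rewrite mulrDr mulr1; set u := K1 * (C * _).
  have : K1 <= K1 * r by rewrite ler_peMr // ltW.
  have : K0 <= K0 * r by rewrite ler_peMr // ltW.
  by lra.
- by apply/cut_projectP; exists n'.
- apply/patch_equivP => // k i kO; apply: pat.
  apply: le_trans ((abP r _ r0).2 kO) _.
  by rewrite mulrC ler_pM2l.
Qed.

(** If every L_i(n) is an integer, (n, L(n)) is an integer vector in E. Translation by it preserves
    both the strip and the coset, hence Y, so aperiodicity makes it 0. *)
Lemma aperiodic_ker_mod1 (R : realType) (d c : nat)
    (L : 'I_c -> {scalar 'rV[R]_d}) (F : {vspace 'rV[R]_(d + c)})
    (x0 : 'rV[R]_(d + c)) :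
  admissible_internal L F ->
  aperiodic L (cut_project L F (cubical_window R d c) (torus_pi x0)) ->
  forall n, (forall i, n \in ker_mod1 (L i)) -> n = 0.
Proof.
move=> admF aper n nS.
have shift k : cp_point L F x0 (k + n) = cp_point L F x0 k + graph_map L (map_mx intr n).
  rewrite -(proj_pi_graph_map admF) /cp_point -linearD; congr (proj_pi L F _).
  rewrite /strip_lift addrAC; congr (_ + _).
  rewrite /strip_int /graph_map !map_row_mx add_row_mx map_mxD; congr row_mx.
  apply/rowP => i; rewrite !mxE.
  have := nS i; rewrite ker_mod1E => /intrP[z zE].
  rewrite int_formD -[L i _]/(int_form (L i) n) zE.
  by rewrite opprD addrA -intrN floorDrz ?intr_int // intrKfloor opprD opprK intrD.
have : graph_map L (map_mx intr n) = 0.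
  apply: aper; first exact: graph_map_physical.
  apply/seteqP; split=> [_ [y /cut_projectP[k ->] <-]|y /cut_projectP[k ->]].
    by rewrite -shift; apply/cut_projectP; exists (k + n).
  exists (cp_point L F x0 (k - n)); first by apply/cut_projectP; exists (k - n).
  by rewrite -shift subrK.
move=> /(congr1 lsubmx); rewrite row_mxKl linear0 => n0.
by apply: (@map_intmx_inj R); rewrite n0 map_mx0.
Qed.

Unset Implicit Arguments.

Theorem theorem1p1 (R : realType) (d k : nat) (d_ge1 : (1 <= d)%N)
    (d_lt_k : (d < k)%N)
    (L : 'I_(k - d) -> {scalar 'rV[R]_d})
    (F : {vspace 'rV[R]_(d + (k - d))})
    (s : torus R (d + (k - d)))
    (Omega : set 'rV[R]_(d + (k - d))) :
  cubical_cut_project L F s ->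
  patch_shape L Omega ->
  (linearly_repetitive L F (cubical_window R d (k - d)) s Omega <->
   ((\sum_(i < k - d) rk (ker_mod1 (L i)))%N = (d * (k - d - 1))%N /\
    forall i : 'I_(k - d), relatively_badly_approximable (L i))).
Proof.
move=> [admF _ irr aper] sO.
have [x0 sE] : exists x0, s = torus_pi x0 by exists (repr s); rewrite /torus_pi reprK.
rewrite sE in aper *; rewrite (linearly_repetitiveP _ admF sO).
apply: lattice_repetitiveP; rewrite ?subn_gt0 //.
  exact: totally_irrational_dense_mod1.
exact: aperiodic_ker_mod1 aper.
Qed.
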